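(* Let $S$ be a discrete semigroup with $|S|=\kappa$, where $\kappa$ is a regular (infinite) cardinal, and suppose $S$ is very weakly cancellative. Then there is a minimal left ideal $L$ of $\beta S$ (equivalently, of $U(S)$) such that: (1) $L$ is a weak $P_{\kappa^+}$-set in $U(S)$; and, if $S$ is moreover left cancellative, then also (2) $L$ is prime in $U(S)$, i.e., for all $p,q\in U(S)$, $p\cdot q\in L$ if and only if $q\in L$; (3) every idempotent in $L$ is left-maximal in $U(S)$ (in particular, every idempotent in $L$ is simultaneously minimal and maximal among the idempotents of $U(S)$).
   Context: $\beta S$ is the set of all ultrafilters on $S$ (points of $S$ being identified with principal ultrafilters), topologized by the basic open sets $\overline{A}=\{p\in\beta S: A\in p\}$, $A\subseteq S$. $U(S)$ is the set of uniform ultrafilters, i.e., those $p\in\beta S$ all of whose members have cardinality $|S|$, with the subspace topology. The operation of $S$ extends to $\beta S$ by $p\cdot q=\{A\subseteq S:\{s\in S: s^{-1}A\in q\}\in p\}$, where $s^{-1}A=\{t\in S: s\cdot t\in A\}$; thus $x\mapsto x\cdot p$ is continuous on $\beta S$ for each $p\in\beta S$ and $x\mapsto s\cdot x$ is continuous for each $s\in S$. For $s\in S$ let $\lambda_s(x)=s\cdot x$ and $\rho_s(x)=x\cdot s$. $S$ is very weakly cancellative if $|\lambda_s^{-1}(t)|<|S|$ and $|\rho_s^{-1}(t)|<|S|$ for all $s,t\in S$. $S$ is left cancellative if every $\lambda_s$ is one-to-one. If $|S|$ is regular and $S$ is very weakly cancellative, then $U(S)$ is a two-sided ideal of $\beta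 S$, hence a semigroup, and the minimal left ideals of $U(S)$ are exactly those of $\beta S$. A left ideal of a semigroup $T$ is a nonempty $L\subseteq T$ with $T\cdot L\subseteq L$; it is minimal if it properly contains no other left ideal. A subset $X$ of a topological space $Y$ is a weak $P_\mu$-set in $Y$ if $\overline{D}\cap X=\emptyset$ for every $D\subseteq Y\setminus X$ with $|D|<\mu$. For idempotents $p,q$: $p\le_L q$ iff $p\cdot q=p$; $p\le_R q$ iff $q\cdot p=p$; $p\le q$ iff $p\le_L q$ and $p\le_R q$. An idempotent $p\in U(S)$ is left-maximal in $U(S)$ if for every idempotent $q\in U(S)$, $p\le_L q$ implies $q\le_L p$. ''Minimal'' and ''maximal'' without qualification refer to $\le$ among the idempotents of $U(S)$. *)

(* Defs.v *)
From HB Require Import structures.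
From mathcomp Require Import all_boot.
From mathcomp Require Import all_classical topology.

Set Implicit Arguments.
Unset Strict Implicit.
Unset Printing Implicit Defensive.

Local Open Scope classical_set_scope.
Local Open Scope card_scope.
Local Open Scope group_scope.

(* Cardinals are represented by sets of that cardinality. *)

Definition card_lt T U (A : set T) (B : set U) : Prop :=
  A #<= B /\ ~ (B #<= A).
Notation "A '#<' B" := (card_lt A B)
  (at level 79, format "A  '#<'  B") : card_scope.

(* An infinite cardinal is regular if it is not the union of fewer than |K|
   sets, each of cardinality less than |K|. *)
Definition regular_card T (K : set T) : Prop :=
  infinite_set K /\
  forall F : set (set T), F #< K -> (forall A, F A -> A `<=` K /\ A #< K) ->
    \bigcup_(A in F) A <> K.

(* |M| = |K|^+ ; such an M always exists, see [succ_card_ex]. *)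
Definition is_succ_card T V (K : set T) (M : set V) : Prop :=
  K #< M /\ forall (U : Type) (N : set U), K #< N -> M #<= N.

(* Zorn's lemma is applied to sets of choice functions of P that are pairwise
   different at every member of P. *)
Lemma min_card_ex U (P : set (set U)) :
  P !=set0 -> exists2 M, P M & forall N, P N -> M #<= N.
Proof.
move=> [N1 PN1].
have [N10|/set0P [x0 Nx0]] := eqVneq N1 set0.
  by exists N1 => // N _; rewrite N10 card_ge0.
pose ok (G : set (set U -> U)) :=
  (forall g N, G g -> P N -> N (g N)) /\
  (forall g h N, G g -> G h -> P N -> g N = h N -> g = h).
have [F Fok Ftot|G [[Gin Ginj] Gmax]] := @Zorn_bigcup _ ok.
  split=> [g N [G FG Gg] PN|g h N [G FG Gg] [H FH Hh] PN].
    by have [in_N _] := Fok _ FG; exact: in_N Gg PN.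
  have [GH|HG] := Ftot _ _ FG FH.
    by have [_ eq_N] := Fok _ FH; exact: eq_N (GH _ Gg) Hh PN.
  by have [_ eq_N] := Fok _ FG; exact: eq_N Gg (HG _ Hh) PN.
have [M PM GM] : exists2 M, P M & M `<=` [set g M | g in G].
  apply: contrapT => noM.
  have ex N : exists x, P N -> N x /\ ~ [set g N | g in G] x.
    have [PN|nPN] := pselect (P N); last by exists x0.
    apply: contrapT => nx; apply: noM; exists N => // x Nx.
    by apply: contrapT => nGx; apply: nx; exists x.
  have [f fP] := choice ex.
  have nGf : ~ G f.
    by move=> Gf; have [_ []] := fP _ PN1; exists f.
  apply: (Gmax (G `|` [set f])).
    by split=> [g Gg|/(_ f)]; [left|move=> sub; apply/nGf/sub; right].
  split=> [g N [Gg|->] PN|g h N [Gg|->] [Gh|->] PN //].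
  - exact: Gin Gg PN.
  - by have [] := fP _ PN.
  - exact: Ginj Gg Gh PN.
  - by move=> e; have [_ []] := fP _ PN; exists g.
  - by move=> e; have [_ []] := fP _ PN; exists h.
exists M => // N PN.
apply: card_le_trans (subset_card_le GM) _.
apply: card_le_trans (card_image_le _ _) _.
have /card_eqPle[_ GN] : [set g N | g in G] #= G.
  by apply: inj_card_eq => g h /set_mem Gg /set_mem Gh; exact: Ginj Gg Gh PN.
apply: card_le_trans GN _; apply: subset_card_le => _ [g Gg <-].
exact: Gin Gg PN.
Qed.

Lemma card_le_total T U (A : set T) (B : set U) : A #<= B \/ B #<= A.
Proof.
pose A' := inl @` A : set (T + U); pose B' := inr @` B : set (T + U).
have /card_eqPle[A'A AA'] : A' #= A by apply: inj_card_eq => x y _ _ [].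
have /card_eqPle[B'B BB'] : B' #= B by apply: inj_card_eq => x y _ _ [].
have [|M [->|->] Mmin] := @min_card_ex _ [set A'; B'].
- by exists A'; left.
- left; apply: card_le_trans AA' _; apply: card_le_trans _ B'B.
  by apply: Mmin; right.
- right; apply: card_le_trans BB' _; apply: card_le_trans _ A'A.
  by apply: Mmin; left.
Qed.

Lemma card_lt_power T (K : set T) : K #< [set: set T].
Proof.
split.
  apply: card_le_trans (subset_card_le (@subsetT _ ((fun x => [set x]) @` K))).
  have /card_eqPle[_ //] : ((fun x : T => [set x]) @` K) #= K.
  by apply: inj_card_eq => x y _ _ /seteqP[/(_ x erefl)].
move=> /card_leP[f].
pose g (A : set T) : T := val (f (SigSub (mem_set (I : [set: set T] A)))).
have ginj : injective g.
  move=> A B /val_inj; move/(inj (mem_set I) (mem_set I)).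
  by move=> /(congr1 val).
pose D := [set x | exists2 A, g A = x & ~ A x].
have [Dx|nDx] := pselect (D (g D)); last by apply: (nDx); exists D.
by case: (Dx) => A /ginj ->; apply.
Qed.

Lemma succ_card_ex T (K : set T) : exists M : set (set T), is_succ_card K M.
Proof.
have [|M KM Mmin] := @min_card_ex _ [set N : set (set T) | K #< N].
  by exists setT; exact: card_lt_power.
exists M; split=> // U N [KN nNK].
have [//|/pcard_leP[f]] := card_le_total M N.
have /card_eqPle[fN Nf] : f @` N #= N by exact: card_image.
apply: card_le_trans fN; apply: Mmin; split; first exact: card_le_trans Nf.
by move=> fK; apply: nNK; exact: card_le_trans fK.
Qed.

Lemma lt_succ_card T V W (K : set T) (M : set V) (D : set W) :
  is_succ_card K M -> (D #< M <-> D #<= K).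
Proof.
move=> [[KM nMK] Mmin]; split=> [[DM nMD]|DK].
  have [//|KD] := card_le_total D K.
  by apply: contrapT => nDK; exact/nMD/Mmin.
split; first exact: card_le_trans KM.
by move=> MD; apply: nMK; exact: card_le_trans DK.
Qed.

Record beta (T : Type) := Beta {
  beta_set :> set T -> Prop;
  beta_ultra : UltraFilter beta_set
}.
#[global] Existing Instance beta_ultra.

Lemma beta_eqP T (p q : beta T) : (forall A, p A <-> q A) -> p = q.
Proof.
case: p q => [p pU] [q qU] /= pq.
have e : p = q by apply/seteqP; split=> A /pq.
by case: q / e qU {pq} => qU; congr Beta; exact: Prop_irrelevance.
Qed.

HB.instance Definition _ T := gen_eqMixin (beta T).
HB.instance Definition _ T := gen_choiceMixin (beta T).

Definition beta_base T (A : set T) : set (beta T) := [set p : beta T | p A].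

Lemma beta_base_cover T :
  \bigcup_(A in [set: set T]) beta_base A = [set: beta T].
Proof. by apply/seteqP; split=> // p _; exists setT => //; exact: filterT. Qed.

Lemma beta_base_join T (A B : set T) (p : beta T) :
  [set: set T] A -> [set: set T] B -> beta_base A p -> beta_base B p ->
  exists C, [/\ [set: set T] C, beta_base C p &
                beta_base C `<=` beta_base A `&` beta_base B].
Proof.
move=> _ _ pA pB; exists (A `&` B); split=> //; first exact: filterI.
by move=> q qAB; split; apply: filterS qAB => x [].
Qed.

HB.instance Definition _ T :=
  isBaseTopological.Build (beta T) (@beta_base_cover T) (@beta_base_join T).

Definition uniform_ultrafilters (S : Type) : set (beta S) :=
  [set p : beta S | forall A, p A -> A #= [set: S]].
Arguments uniform_ultrafilters S _ : clear implicits.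

Lemma ultra_of_setVsetC T (F : set_system T) : ProperFilter F ->
  (forall A, F A \/ F (~` A)) -> UltraFilter F.
Proof.
move=> FF FC; split=> // G GF FG; apply/seteqP; split=> // A GA.
have [//|/FG GnA] := FC A.
by exfalso; apply: (@filter_not_empty _ G); rewrite -(setICr A); exact: filterI.
Qed.

Section BetaMul.
Variable S : magmaType.

Definition beta_mul_set (p q : set_system S) : set_system S :=
  [set A | p [set s | q [set t | A (s * t)]]].

Lemma beta_mul_ultra (p q : beta S) : UltraFilter (beta_mul_set p q).
Proof.
have pS (r : beta S) (A B : set S) : A `<=` B -> r A -> r B by exact: filterS.
have pI (r : beta S) (A B : set S) : r A -> r B -> r (A `&` B).
  exact: filterI.
have pT (r : beta S) : r setT by exact: filterT.
have p0 (r : beta S) : ~ r set0 by exact: filter_not_empty.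
have pC (r : beta S) (A : set S) : r A \/ r (~` A).
  exact: in_ultra_setVsetC.
apply: ultra_of_setVsetC => [|A].
  split; first by move=> q0; apply: (p0 p); apply: pS q0 => s /= /p0.
  split=> [|A B pA pB|A B AB pA].
  - by apply: pS (pT p) => s _; exact: pT.
  - by apply: pS (pI _ _ _ pA pB) => s [qA qB]; exact: (pI q _ _ qA qB).
  - by apply: (pS p _ _ _ pA) => s qA; apply: (pS q _ _ _ qA) => t /AB.
have [pA|pnA] := pC p [set s | q [set t | A (s * t)]]; [by left|right].
by apply: pS pnA => s nqA; have [] := pC q [set t | A (s * t)].
Qed.

Definition beta_mul (p q : beta S) : beta S := Beta (beta_mul_ultra p q).

End BetaMul.

Lemma beta_mulA (S : semigroupType) : associative (@beta_mul S).
Proof.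
move=> p q r; apply: beta_eqP => A; rewrite /= /beta_mul_set /=.
have eqp (P Q : set S) : P = Q -> (p P <-> p Q) by move=> ->.
apply: eqp; apply/funext => s /=; congr (beta_set q _).
apply/funext => t /=; congr (beta_set r _).
by apply/funext => u /=; rewrite mulgA.
Qed.

HB.instance Definition _ (S : semigroupType) :=
  isSemigroup.Build (beta S) (@beta_mulA S).

Lemma beta_mulE (S : semigroupType) (p q : beta S) (A : set S) :
  (p * q)%g A <-> p [set s | q [set t | A (s * t)]].
Proof. by []. Qed.

Definition very_weakly_cancellative (S : semigroupType) : Prop :=
  forall s t : S,
    (fun x => s * x) @^-1` [set t] #< [set: S] /\
    (fun x => x * s) @^-1` [set t] #< [set: S].

Definition left_cancellative (S : semigroupType) : Prop :=
  forall s : S, injective (fun x => s * x).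

(* X is a weak P_mu-set in the subspace Y of Z, where mu = |M|.  The carrier of
   [subspace Y] is all of Z, but for D included in Y the closure below is the
   closure of D in Y, see [closure_subspaceW]. *)
Definition weak_Pset V (M : set V) (Z : topologicalType) (Y X : set Z) : Prop :=
  X `<=` Y /\
  forall D : set Z, D `<=` Y `\` X -> D #< M ->
    closure (D : set (subspace Y)) `&` X = set0.

Section Semigroups.
Variable G : semigroupType.
Implicit Types (T L : set G) (p q : G).

(* Below, T is meant to be a subsemigroup of G. *)

Definition left_ideal T L : Prop :=
  [/\ L !=set0, L `<=` T & forall p q, T p -> L q -> L (p * q)].

Definition minimal_left_ideal T L : Prop :=
  left_ideal T L /\ forall L', left_ideal T L' -> ~ L' `<` L.

Definition prime_in T L : Prop :=
  forall p q, T p -> T q -> (L (p * q) <-> L q).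

Definition idempotent_elt p : Prop := p * p = p.

Definition idem_leL p q : Prop := p * q = p.
Definition idem_leR p q : Prop := q * p = p.
Definition idem_le p q : Prop := idem_leL p q /\ idem_leR p q.

Definition idempotents T : set G := [set p | T p /\ idempotent_elt p].

Definition left_maximal_idempotent T p : Prop :=
  idempotents T p /\
  forall q, idempotents T q -> idem_leL p q -> idem_leL q p.

Definition minimal_idempotent T p : Prop :=
  idempotents T p /\ forall q, idempotents T q -> idem_le q p -> q = p.

Definition maximal_idempotent T p : Prop :=
  idempotents T p /\ forall q, idempotents T q -> idem_le p q -> q = p.

End Semigroups.

(* Main.v *)
Require Import Defs.
From mathcomp Require Import all_boot.
From mathcomp Require Import all_classical topology.
From mathcomp Require wochoice.

(* Let kappa = |S|.  A minimal left ideal is the set of ultrafilters extending a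
   maximal proper translation-invariant filter F, and F is built as a generic
   filter, in the style of Kunen's weak P-points, from an independent family of
   2^kappa rows.  Rows are functions on an index set of size kappa; they are
   transported to S along pairwise disjoint finite blocks G_y * a_y, which exist
   by very weak cancellation, so that invariance does not interfere with
   independence.

   To separate F from a set M of at most kappa uniform ultrafilters outside L,
   take M of minimal cardinality lambda.  Each proper initial segment of M is
   missed by some U_eta in F, and genericity provides V_th in F, for th in the
   cardinal lambda^+, with V_al /\ V_th contained in U_(e al th) up to fewer than
   kappa points, where e (-, th) injects th into M.  If every V_th belonged to a
   member of M, some p in M would contain more than lambda of them; then e takes
   on pairs of such indices only values below or equal to p, which is impossible
   as e (-, th) is injective.  The almost disjointness needed for the V_th is
   that of a tree of almost disjoint families, built along kappa^+.

   Primeness: if p * q is in L then some s * q is, because L is not in the closure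
   of kappa many points outside it; an idempotent e of L then satisfies
   s * (q * e) = s * q, and left cancellation gives q = q * e, a member of L. *)

Set Implicit Arguments.
Unset Strict Implicit.
Unset Printing Implicit Defensive.

Local Open Scope classical_set_scope.
Local Open Scope card_scope.

(** * Well-orders and cardinal arithmetic *)

Lemma card_le_of_inj T U (A : set T) (B : set U) (f : T -> U) :
  (forall x, A x -> B (f x)) ->
  (forall x y, A x -> A y -> f x = f y -> x = y) -> A #<= B.
Proof.
move=> fAB finj; have /card_eqPle[_ Af] : f @` A #= A.
  by apply: inj_card_eq => x y /set_mem Ax /set_mem Ay; exact: finj.
by apply: card_le_trans Af _; apply: subset_card_le => _ [x Ax <-]; exact: fAB.
Qed.

Lemma card_le_injP T U (u : U) (A : set T) (B : set U) : A #<= B ->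
  exists2 f : T -> U, forall x, A x -> B (f x) &
    forall x y, A x -> A y -> f x = f y -> x = y.
Proof.
move=> /card_leP[f].
pose g x := if pselect (A x) is left Ax then val (f (SigSub (mem_set Ax))) else u.
exists g => [x Ax|x y Ax Ay]; rewrite /g.
  by case: pselect => // Ax'; exact: set_mem (valP _).
case: pselect => // Ax'; case: pselect => // Ay' /val_inj.
by move/(inj (mem_set I) (mem_set I)) => /(congr1 val).
Qed.

Lemma card_le_of_surj T U (A : set T) (B : set U) (f : T -> U) :
  (forall y, B y -> exists2 x, A x & f x = y) -> B #<= A.
Proof. by move=> fs; apply: card_le_trans (card_image_le f A); apply: subset_card_le. Qed.

(** Recursion in relational form: [Q] need only be satisfiable when all earlier values obey it, so a
    construction can carry its invariant inside [Q]. *)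
Lemma transfinite_recursion X W (w0 : W) (lt : X -> X -> Prop)
    (Q : X -> (X -> W) -> W -> Prop) :
  well_founded lt ->
  (forall x g g' w, (forall y, lt y x -> g y = g' y) -> Q x g w -> Q x g' w) ->
  (forall x g, (forall y, lt y x -> Q y g (g y)) -> exists w, Q x g w) ->
  exists g, forall x, Q x g (g x).
Proof.
move=> wf Qext Qex.
pose ext x (r : forall y, lt y x -> W) y :=
  if pselect (lt y x) is left h then r y h else w0.
pose F x r := if pselect (exists w, Q x (ext x r) w) is left e
  then projT1 (cid e) else w0.
have Fext x r r' : (forall y (h : lt y x), r y h = r' y h) -> F x r = F x r'.
  move=> rr'; rewrite /F; suff -> : ext x r = ext x r' by [].
  by apply/funext => y; rewrite /ext; case: pselect.
pose g := Fix wf (fun=> W) F.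
have gE x : g x = F x (fun y _ => g y) by rewrite /g Fix_eq.
exists g; elim/(well_founded_ind wf) => x IH.
have ee y : lt y x -> ext x (fun y _ => g y) y = g y.
  by rewrite /ext; case: pselect.
have [w Qw] := Qex _ _ IH.
have Qe : exists w, Q x (ext x (fun y _ => g y)) w.
  by exists w; apply: Qext Qw => y /ee ->.
rewrite gE /F; apply: Qext ee _; case: pselect => // e.
exact: (projT2 (cid e)).
Qed.

Lemma well_founded_min X (lt : X -> X -> Prop) (A : set X) : well_founded lt ->
  A !=set0 -> exists2 x, A x & forall y, A y -> ~ lt y x.
Proof.
move=> wf [x Ax]; apply: contrapT => nmin.
have : forall x, ~ A x; last by move/(_ x).
elim/(well_founded_ind wf) => {Ax} x IH Ax; apply: nmin.
by exists x => // y Ay /IH.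
Qed.

Definition strict_well_order T (lt : T -> T -> Prop) :=
  [/\ well_founded lt, forall x y z, lt x y -> lt y z -> lt x z &
      forall x y, lt x y \/ x = y \/ lt y x].

Lemma strict_well_order_ex T : exists lt : T -> T -> Prop, strict_well_order lt.
Proof.
(* The principle gives each nonempty set a unique least element; the order axioms come from sets of
   two or three points. *)
elim/Pchoice: T => T; have [R Rwo] := wochoice.well_ordering_principle T.
have min2 (A : set T) : A !=set0 -> exists2 x, A x & forall y, A y -> R x y.
  move=> [a Aa]; have [|x [[Ax xmin] _]] := Rwo (mem A).
    by exists a; exact: mem_set.
  exists x => [|y Ay]; first exact: set_mem.
  exact/xmin/mem_set.
have minu (A : set T) x y : A x -> A y -> (forall z, A z -> R x z) ->
    (forall z, A z -> R y z) -> x = y.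
  move=> Ax Ay xm ym; have [|z [_ zu]] := Rwo (mem A).
    by exists x; exact: mem_set.
  rewrite -(zu x) ?(zu y) //; split; try exact: mem_set.
  - by move=> t /set_mem; exact: ym.
  - by move=> t /set_mem; exact: xm.
have Rtot x y : R x y \/ R y x.
  have [|z [->|->] zm] := min2 [set x; y]; first by exists x; left.
    by left; apply: zm; right.
  by right; apply: zm; left.
have Rxx x : R x x by have [] := Rtot x x.
have Ranti x y : R x y -> R y x -> x = y.
  move=> Rxy Ryx; apply: (minu [set x; y]); [by left|by right| |].
  - by move=> z [->|->].
  - by move=> z [->|->].
have Rtr x y z : R x y -> R y z -> R x z.
  move=> Rxy Ryz; have [|t tA tm] := min2 [set x; y; z].
    by exists x; left; left.
  have Rtx : R t x by apply: tm; left; left.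
  have Rty : R t y by apply: tm; left; right.
  have Rtz : R t z by apply: tm; right.
  case: tA => [[|]|] /= tE; subst t => //; first by rewrite (Ranti _ _ Rxy Rtx).
  by rewrite -(Ranti _ _ Ryz Rty).
exists (fun x y => R x y /\ x <> y); split.
- move=> x; apply: contrapT => nx.
  have [|y nAy ym] := min2 [set x | ~ Acc (fun x y => R x y /\ x <> y) x].
    by exists x.
  apply: nAy; split=> z [Rzy zy]; apply: contrapT => /ym Ryz.
  by apply: zy; exact: Ranti.
- move=> x y z [Rxy xy] [Ryz yz]; split; first exact: Rtr Ryz.
  by move=> xz; subst z; apply: xy; exact: Ranti.
- move=> x y; have [->|xy] := eqVneq x y; first by right; left.
  move/eqP: xy => xy.
  by have [] := Rtot x y; [left|right; right; split=> //; exact/nesym].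
Qed.

Definition initial_well_order T (A : set T) (lt : T -> T -> Prop) :=
  [/\ well_founded lt, forall x y z, lt x y -> lt y z -> lt x z,
      forall x y, A x -> A y -> lt x y \/ x = y \/ lt y x &
      forall x, A x -> ~ (A #<= [set y | A y /\ lt y x])].

(** Take the least [x] whose segment in [A] is as large as [A], and pull the order back along an
    injection [f] of [A] into that segment. A new segment as large as [A], at [a], would contradict
    leastness through [f a]. *)
Lemma initial_well_order_ex T (A : set T) :
  exists lt : T -> T -> Prop, initial_well_order A lt.
Proof.
have [lt [wf tr tot]] := strict_well_order_ex T.
have [[x Bx]|nB] := pselect
    ([set x | A x /\ (A #<= [set y | A y /\ lt y x])] !=set0); last first.
  exists lt; split=> // x Ax Ale.
  by apply: nB; exists x.
have [{Bx}x [Ax Ale] xmin] := well_founded_min wf (ex_intro _ x Bx).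
have [f fA finj] := card_le_injP x Ale.
exists (fun a b => lt (f a) (f b)); split.
- suff h c a : f a = c -> Acc (fun a b => lt (f a) (f b)) a by move=> a; exact: h.
  move: c a.
  elim/(well_founded_ind wf) => c IH a fa; split=> b; rewrite fa => fb.
  exact: (IH (f b)).
- by move=> a b c; exact: tr.
- move=> a b Aa Ab; have [|[fab|]] := tot (f a) (f b); [by left| |by right; right].
  by right; left; exact: finj.
move=> a Aa Ale'; have [Afa fax] := fA _ Aa.
apply: (xmin (f a)) => //; split=> //; apply: card_le_trans Ale' _.
apply: (@card_le_of_inj _ _ _ _ f) => [y [Ay fya]|y z [Ay _] [Az _]].
  by split=> //; have [] := fA _ Ay.
exact: finj.
Qed.

Lemma card_le_of_small_preds X T (B : set X) (A : set T) (lt : X -> X -> Prop) :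
  well_founded lt -> (forall x y, B x -> B y -> lt x y \/ x = y \/ lt y x) ->
  (forall x, B x -> ~ (A #<= [set y | B y /\ lt y x])) -> B #<= A.
Proof.
move=> wf tot small.
have [[t At]|A0] := pselect (A !=set0); last first.
  have [->|/set0P[x Bx]] := eqVneq B set0; first exact: card_ge0.
  exfalso; apply: (small x Bx); suff -> : A = set0 by exact: card_ge0.
  by have [//|/set0P] := eqVneq A set0.
have [] := @transfinite_recursion X T t lt
  (fun x g a => B x -> A a /\ forall y, B y -> lt y x -> g y <> a) wf.
- move=> x g g' a gg' h Bx; have [Aa ha] := h Bx.
  by split=> // y By yx; rewrite -gg' //; exact: ha.
- move=> x g _; have [Bx|nBx] := pselect (B x); last by exists t.
  apply: contrapT => na; apply: (small x Bx).
  apply: (@card_le_of_surj _ _ _ _ g) => a Aa.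
  apply: contrapT => ny; apply: na; exists a => _; split=> // y By yx gya.
  by apply: ny; exists y.
move=> g gP; apply: (@card_le_of_inj _ _ _ _ g) => [x /gP[]//|x y Bx By gxy].
have [xy|[//|yx]] := tot x y Bx By; exfalso.
- by have [_ /(_ x Bx xy)] := gP y By.
- by have [_ /(_ y By yx)] := gP x Bx; apply.
Qed.

Lemma card_setU1_infinite T (B : set T) r : infinite_set B -> B `|` [set r] #<= B.
Proof.
move=> /infiniteP nat_le; have [k kin kinj] := card_le_injP r nat_le.
pose h x := if pselect (x = r) is left _ then k 0%N else
   if pselect (exists n, x = k n) is left e then k (projT1 (cid e)).+1 else x.
have hP x : (x = r /\ h x = k 0%N) \/ (exists2 n, x = k n & h x = k n.+1) \/
    [/\ x <> r, ~ (exists n, x = k n) & h x = x].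
  rewrite /h; case: (pselect (x = r)) => [->|xr]; first by left.
  case: pselect => [e|ne]; last by right; right.
  by right; left; exists (projT1 (cid e)) => //; exact: (projT2 (cid e)).
apply: (@card_le_of_inj _ _ _ _ h) => [x Bx|x y Bx By].
  have [[_ ->]|[[n _ ->]|[xr _ ->]]] := hP x; [exact: kin|exact: kin|].
  by case: Bx.
have kne m n : k m = k n -> m = n by exact: kinj.
have [[-> ->]|[[m xm ->]|[xr xk ->]]] := hP x;
  have [[-> ->]|[[n yn ->]|[yr yk ->]]] := hP y => //.
- by move/kne.
- by move=> e; case: yk; exists 0%N.
- by move/kne.
- by move/kne => [mn]; rewrite xm yn mn.
- by move=> e; case: yk; exists m.+1.
- by move=> e; case: xk; exists 0%N.
- by move=> e; case: xk; exists n.+1.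
Qed.

(* Goedel's ordering: pairs are ordered first by their larger component, so that
   proper initial segments of M * M lie in squares of proper segments of M. *)
Lemma card_setM_infinite T (A : set T) : infinite_set A -> A `*` A #<= A.
Proof.
move=> infA; apply: contrapT => nAA.
have [|M [infM nMM] Mmin] := @min_card_ex T
    [set N : set T | infinite_set N /\ ~ (N `*` N #<= N)].
  by exists A.
apply: nMM; have [lt [wf tr tot ini]] := initial_well_order_ex M.
have [R [Rwf _ Rtot]] := strict_well_order_ex (T * T).
(* [rho p] is the larger component; [R] only breaks ties. *)
pose rho (p : T * T) := if pselect (lt p.1 p.2) then p.2 else p.1.
pose lex p q := lt (rho p) (rho q) \/ (rho p = rho q /\ R p q).
have Mrho p : (M `*` M) p -> M (rho p).
  by case: p => a b [/= Ma Mb]; rewrite /rho /=; case: pselect.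
apply: (@card_le_of_small_preds _ _ _ _ lex).
- have : forall c p, rho p = c -> Acc lex p; last by move=> h p; exact: h.
  elim/(well_founded_ind wf) => c IHc p; move: p.
  elim/(well_founded_ind Rwf) => p IHp pc; split=> q [qp|[qp Rqp]].
    by apply: (IHc (rho q)) => //; rewrite -pc.
  by apply: IHp => //; rewrite qp.
- move=> p q Mp Mq; have [|[e|]] := tot _ _ (Mrho _ Mp) (Mrho _ Mq).
  + by left; left.
  + have [|[->|]] := Rtot p q; [by left; right|by right; left|].
    by right; right; right.
  + by right; right; left.
move=> p Mp Mle; pose seg := [set x | M x /\ (lt x (rho p) \/ x = rho p)].
have segM : seg `<=` M by move=> x [].
have sub : [set q | (M `*` M) q /\ lex q p] `<=` seg `*` seg.
  move=> [a b] [[/= Ma Mb] ab].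
  have ab_p : lt (rho (a, b)) (rho p) \/ rho (a, b) = rho p.
    by case: ab => [h|[h _]]; [left|right].
  have le_seg x : M x -> lt x (rho (a, b)) \/ x = rho (a, b) -> seg x.
    move=> Mx [xr|->]; last by split=> //; exact: (Mrho (a, b)).
    split=> //; left; case: ab_p => [|<-//]; exact: tr.
  have rhoab : (lt a b /\ rho (a, b) = b) \/ (~ lt a b /\ rho (a, b) = a).
    by rewrite /rho /=; case: pselect; [left|right].
  split=> /=; apply: le_seg => //; case: rhoab => [[lab ->]|[lab ->]]; try by [left|right].
  by have [//|[ab'|]] := tot _ _ Ma Mb; [right|left].
have {}Mle := card_le_trans Mle (subset_card_le sub).
have finseg_no : ~ finite_set (seg `*` seg).
  by move=> fs; apply: infM; exact: card_le_finite Mle fs.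
have infseg : infinite_set seg.
  by move=> fs; apply: finseg_no; exact: finite_setX.
have nMseg : ~ (M #<= seg).
  move=> Ms; apply: (ini _ (Mrho _ Mp)); apply: card_le_trans Ms _.
  have segE : seg = [set y | M y /\ lt y (rho p)] `|` [set rho p].
    apply/seteqP; split=> x.
      by move=> [Mx [h|->]]; [left|right].
    by move=> [[Mx h]|->]; [split=> //; left|split; [exact: Mrho|right]].
  rewrite segE; apply: card_setU1_infinite => fs; apply: infseg.
  by rewrite segE finite_setU; split=> //; exact: finite_set1.
(* [M] is a counterexample of least cardinality, so [seg] is not one unless [M] injects into it. *)
apply: (nMseg); apply: card_le_trans Mle _; apply: contrapT => nss.
by apply: nMseg; exact: Mmin.
Qed.

(** * Small sets *)

(** By comparability of cardinals this is |A| < |S|. *)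
Definition small (S : Type) T (A : set T) : Prop := ~ ([set: S] #<= A).

Section Small.
Variable S : Type.
Hypothesis S_regular : regular_card [set: S].

Let S_infinite : infinite_set [set: S] := proj1 S_regular.

Lemma regular_inhabited : inhabited S.
Proof. by have [x _] := infinite_setN0 S_infinite; exact: inhabits. Qed.

Lemma small_le T U (A : set T) (B : set U) : A #<= B -> small S B -> small S A.
Proof. by move=> AB sB SA; apply: sB; exact: card_le_trans AB. Qed.

Lemma small_sub T (A B : set T) : A `<=` B -> small S B -> small S A.
Proof. by move=> /subset_card_le; exact: small_le. Qed.

Lemma small_image T U (f : T -> U) (A : set T) : small S A -> small S (f @` A).
Proof. exact/small_le/card_image_le. Qed.

Lemma small_finite T (A : set T) : finite_set A -> small S A.
Proof. by move=> fA SA; apply: S_infinite; exact: card_le_finite fA. Qed.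

(** An injection of [S] into the union would pull the [A i] back to a cover of [S] that regularity
    forbids. *)
Lemma small_bigcup X T (J : set X) (A : X -> set T) :
  small S J -> (forall i, J i -> small S (A i)) -> small S (\bigcup_(i in J) A i).
Proof.
move=> sJ sA SU; have [x0] := regular_inhabited.
have [t0 _] : (\bigcup_(i in J) A i) !=set0.
  apply/set0P/eqP => U0; move: SU; rewrite U0 card_le0 => /eqP S0.
  by have : [set: S] x0 by []; rewrite S0.
have [f fU finj] := card_le_injP t0 SU.
case: S_regular => _ /(_ ((fun i => f @^-1` (A i)) @` J)); apply.
- split; first by have [//|SF] := card_le_total ((fun i => f @^-1` A i) @` J) [set: S];
    exfalso; apply: sJ; exact: card_le_trans SF (card_image_le _ _).
  by move=> SF; apply: sJ; exact: card_le_trans SF (card_image_le _ _).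
- move=> _ [i Ji <-]; split=> //; split; first exact: card_leT.
  move=> Sf; apply: (sA i Ji); apply: card_le_trans Sf _.
  by apply: (@card_le_of_inj _ _ _ _ f) => // x y _ _; exact: finj.
apply/seteqP; split=> // x _; have [i Ji Aifx] := fU x I.
by exists (f @^-1` A i) => //; exists i.
Qed.

Lemma smallU T (A B : set T) : small S A -> small S B -> small S (A `|` B).
Proof.
move=> sA sB; have -> : A `|` B = \bigcup_(b in [set: bool]) (if b then A else B).
  apply/seteqP; split=> [x [Ax|Bx]|x [[] _]]; [by exists true|by exists false|by left|by right].
by apply: small_bigcup => [|[] _ //]; exact: small_finite.
Qed.

Lemma small_bigcup2 X X' T (J : set X) (J' : set X') (A : X -> X' -> set T) :
  small S J -> small S J' -> (forall i j, J i -> J' j -> small S (A i j)) ->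
  small S (\bigcup_(i in J) \bigcup_(j in J') A i j).
Proof.
by move=> sJ sJ' sA; apply: small_bigcup => // i Ji; apply: small_bigcup => // j; exact: sA.
Qed.

Lemma small_preimage T U (f : T -> U) (A : set T) (B : set U) :
  (forall x, A x -> B (f x)) ->
  (forall x y, A x -> A y -> f x = f y -> x = y) -> small S B -> small S A.
Proof. by move=> fAB finj; apply: small_le; exact: (@card_le_of_inj _ _ _ _ f). Qed.

Lemma small_seq (T : eqType) (s : seq T) : small S [set x | x \in s].
Proof. by apply: small_finite; exact: finite_seq. Qed.

Lemma small_predsT (lt : S -> S -> Prop) x :
  initial_well_order [set: S] lt -> small S [set y | lt y x].
Proof.
by move=> [_ _ _ /(_ x I)]; apply: contra_not => /card_le_trans; apply; exact: subset_card_le.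
Qed.

Lemma small_le_preds (lt : S -> S -> Prop) x :
  initial_well_order [set: S] lt -> small S [set y | ~ lt x y].
Proof.
move=> lt_ini; have : small S ([set y | lt y x] `|` [set x]).
  by apply: smallU; [exact: small_predsT|apply: small_finite; exact: finite_set1].
apply: small_sub => y nxy; case: lt_ini => _ _ tot _.
by have [//|[<-|]] := tot x y I I; [right|left].
Qed.

(** Along an initial well-order of [S], fewer than |S| values are forbidden or taken at stage [m],
    while [T m] offers |S|. *)
Lemma injective_choice (T Av : S -> set S) :
  (forall m, ~ small S (T m)) -> (forall m, small S (Av m)) ->
  exists2 y : S -> S, injective y & forall m, T m (y m) /\ ~ Av m (y m).
Proof.
move=> nT sAv; have [lt lt_ini] := initial_well_order_ex [set: S].
have [wf _ tot _] := lt_ini; have [x0] := regular_inhabited.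
have [] := @transfinite_recursion S S x0 lt
  (fun m g w => [/\ T m w, ~ Av m w & forall k, lt k m -> g k <> w]) wf.
- move=> m g g' w gg' [Tw nAw gw]; split=> // k km; rewrite -gg' //; exact: gw.
- move=> m g _; apply: contrapT => nw; apply: (nT m).
  have : small S (Av m `|` (g @` [set k | lt k m])).
    by apply: smallU => //; apply: small_image; exact: small_predsT.
  apply: small_sub => w Tw; apply: contrapT => /not_orP[nA nG].
  apply: nw; exists w; split=> // k km gk; apply: nG; by exists k.
move=> y yP; exists y => [m n ymn|m]; last by have [] := yP m.
have [mn|[//|nm]] := tot m n I I; exfalso.
- by have [_ _ /(_ _ mn)] := yP n.
- by have [_ _ /(_ _ nm)] := yP m; apply.
Qed.

Lemma pair_code_ex : exists c : S * S -> S, injective c.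
Proof.
have [x0] := regular_inhabited.
have [c _ cinj] := card_le_injP x0 (card_setM_infinite S_infinite).
by exists c => x y; exact: cinj.
Qed.

Lemma nat_code_ex : exists k : nat -> S, injective k.
Proof.
have [x0] := regular_inhabited; move: S_infinite => /infiniteP/(card_le_injP x0)[k _ kinj].
by exists k => x y; exact: kinj.
Qed.

Lemma seq_code_ex : exists f : seq S -> S, injective f.
Proof.
have [x0] := regular_inhabited; have [c cinj] := pair_code_ex.
have [k kinj] := nat_code_ex.
(* The length is stored because the fold alone does not show where a list ends. *)
exists (fun s => c (k (size s), foldr (fun x y => c (x, y)) x0 s)).
elim=> [|x s IH] [|y t] // /cinj e; have [/kinj //= [st] /cinj[-> e']] := e.
by congr cons; apply: IH; rewrite st e'.
Qed.

(** Let [d] read [q] off the code [c (f q, y)]; every fibre then contains a copy of [S]. *)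
Lemma large_fibers_ex (Q : Type) (q0 : Q) (f : Q -> S) : injective f ->
  exists d : S -> Q, forall q, ~ small S [set x | d x = q].
Proof.
move=> finj; have [c cinj] := pair_code_ex.
have /choice[d dP] : forall x, exists q, forall q' y, x = c (f q', y) -> q = q'.
  move=> x; have [[q [y xE]]|nx] := pselect (exists q y, x = c (f q, y)).
    by exists q => q' y' xE'; move: xE; rewrite xE' => /cinj[/finj].
  by exists q0 => q y xE; exfalso; apply: nx; exists q, y.
exists d => q; apply; apply: (@card_le_of_inj _ _ _ _ (fun y => c (f q, y))) => [y _|y z _ _].
  exact: dP.
by move=> /cinj[].
Qed.

End Small.

(** * The tree of sets *)

Section Tree.
Variables (S : Type) (I : eqType) (Q : Type) (lt : I -> I -> Prop) (d : S -> Q * S).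
Hypothesis S_regular : regular_card [set: S].
Hypothesis lt_wo : strict_well_order lt.
Hypothesis lt_preds : forall th, [set a | lt a th] #<= [set: S].
Hypothesis d_large : forall q, ~ small S [set x | d x = q].

Definition gtb : rel I := fun a b => `[< lt b a >].
Definition below th (tau : seq I) := path gtb th tau.

Let lt_wf : well_founded lt. Proof. by case: lt_wo. Qed.
Let lt_trans x y z : lt x y -> lt y z -> lt x z.
Proof. by case: lt_wo => _ tr _; exact: tr. Qed.
Let lt_tot x y : lt x y \/ x = y \/ lt y x. Proof. by case: lt_wo. Qed.

Lemma lt_irr x : ~ lt x x.
Proof. by elim/(well_founded_ind lt_wf): x => x IH xx; exact: (IH x xx xx). Qed.

Lemma gtb_trans : transitive gtb.
Proof. by move=> y x z /asboolP yx /asboolP zy; apply/asboolP; exact: lt_trans yx. Qed.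

Lemma below_cons th a tau : below th (a :: tau) -> lt a th /\ below a tau.
Proof. by move=> /= /andP[/asboolP]. Qed.

Lemma below_tail th a tau : below th (a :: tau) -> below th tau.
Proof. by rewrite /below !(path_sortedE gtb_trans) /= => /andP[/andP[_ ->]] /path_sorted. Qed.

Lemma below_mem th tau a : below th tau -> a \in tau -> lt a th.
Proof.
by rewrite /below (path_sortedE gtb_trans) => /andP[/allP h _] /h /asboolP.
Qed.

Lemma below_inj th tau tau' : below th tau -> below th tau' -> tau =i tau' -> tau = tau'.
Proof.
move=> /path_sorted s /path_sorted s'; apply: irr_sorted_eq s s'.
  exact: gtb_trans.
by move=> x; apply/asboolP; exact: lt_irr.
Qed.

(* For every node tau (a decreasing list of indices) the sets node (th :: tau) are
   subsets of node tau meeting each column of tau in at most one point.  Having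
   small columns is a property preserved by diagonal unions of kappa sets, which
   lets the recursion pass through all stages th. *)
Section Stage.
Variable z : I -> seq I -> set S * (S -> S).

Definition node tau : set S := if tau is th :: tau' then (z th tau').1 else setT.
Definition column tau : S -> S :=
  if tau is th :: tau' then (z th tau').2 else fun y => (d y).2.
Definition trace a : set S := \bigcup_(tau in [set tau | below a tau]) node (a :: tau).
End Stage.

(** The first four clauses become the properties of the finished tree. The fifth makes a whole level
    small on each column of an earlier node; later stages use it to avoid that level. *)
Definition stage th z (w : seq I -> set S * (S -> S)) : Prop :=
  [/\ forall tau, below th tau -> (w tau).1 `<=` node z tau,
      forall tau q i, below th tau ->
        ~ small S [set y | [/\ (w tau).1 y, (d y).1 = q & (w tau).2 y = i]],
      forall tau tau' y, below th tau -> below th tau' ->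
        (w tau).1 y -> (w tau').1 y -> tau = tau',
      forall a, lt a th -> small S [set y | trace z a y /\
        exists tau, [/\ below th tau, a \notin tau & (w tau).1 y]] &
      forall tau i, below th tau -> small S [set y | [/\ node z tau y, column z tau y = i &
        exists2 tau', below th tau' & (w tau').1 y]]].

Lemma stage_ext th z z' w : (forall a, lt a th -> z a = z' a) ->
  stage th z w -> stage th z' w.
Proof.
move=> zz'; have nodeE tau : below th tau -> node z' tau = node z tau.
  by case: tau => //= a tau /andP[/asboolP/zz' ->].
have colE tau : below th tau -> column z' tau = column z tau.
  by case: tau => //= a tau /andP[/asboolP/zz' ->].
have traceE a : lt a th -> trace z' a = trace z a by move=> ath; rewrite /trace /= zz'.
move=> [q1 q2 q3 q4 q5]; split=> //.
- by move=> tau bt; rewrite nodeE //; exact: q1.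
- by move=> a ath; rewrite traceE //; exact: q4.
- by move=> tau i bt; rewrite nodeE // colE //; exact: q5.
Qed.

Section StageFacts.
Variables (th : I) (z : I -> seq I -> set S * (S -> S)).
Hypothesis IH : forall a, lt a th -> stage a z (z a).

Lemma node_trace tau a : below th tau -> a \in tau -> node z tau `<=` trace z a.
Proof.
elim: tau => // b tau IHt bt; have [bth bbt] := below_cons bt.
rewrite inE => /orP[/eqP -> y|at'] /=; first by exists tau.
have [q1 _ _ _ _] := IH bth.
by apply: subset_trans (q1 _ bbt) _; apply: IHt => //; exact: below_tail bt.
Qed.

(** Compare [a] with the head [b] of [tau]. If [a] comes first, use the fourth clause at stage [b];
    otherwise [tau] is empty or below [a], and the fifth clause at stage [a] applies. *)
Lemma small_trace_node tau a i : below th tau -> lt a th -> a \notin tau ->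
  small S [set y | [/\ trace z a y, node z tau y & column z tau y = i]].
Proof.
case: tau => [|b tau] bt ath nat.
  have [_ _ _ _ /(_ [::] i isT)] := IH ath; apply: small_sub => y [[t bt' zy] _ yi].
  by split=> //; exists t.
have [bth bbt] := below_cons bt; move: nat; rewrite inE negb_or => /andP[/eqP ab nat].
have [lab|[//|lba]] := lt_tot a b.
  have [_ _ _ /(_ a lab) + _] := IH bth; apply: small_sub => y [ty ny _].
  by split=> //; exists tau.
have bat : below a (b :: tau) by apply/andP; split=> //; apply/asboolP.
have [_ _ _ _ /(_ _ i bat)] := IH ath; apply: small_sub => y [[t bt' zy] ny yi].
by split=> //; exists t.
Qed.

Lemma large_node tau q i : below th tau ->
  ~ small S [set y | [/\ node z tau y, (d y).1 = q & column z tau y = i]].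
Proof.
case: tau => [_|b tau bt].
  refine (contra_not _ (@d_large (q, i))); apply: small_sub => y /= ->.
  by split.
have [bth bbt] := below_cons bt; have [_ q2 _ _ _] := IH bth.
exact: q2 bbt.
Qed.

Lemma stage_ex : exists w, stage th z w.
Proof.
have [x0] := regular_inhabited S_regular.
have [j _ jinj] := card_le_injP x0 (lt_preds th).
have [c cinj] := pair_code_ex S_regular; have [f finj] := seq_code_ex S_regular.
pose code (tau : seq I) := f (map j tau).
have codeP tau tau' : below th tau -> below th tau' -> code tau = code tau' -> tau = tau'.
  move=> bt bt' /finj; have : all (fun a => `[< lt a th >]) tau.
    by apply/allP => a /(below_mem bt) ?; apply/asboolP.
  have : all (fun a => `[< lt a th >]) tau'.
    by apply/allP => a /(below_mem bt') ?; apply/asboolP.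
  elim: tau tau' {bt bt'} => [|a t IHt] [|a' t'] //= /andP[/asboolP ha' ht'].
  by move=> /andP[/asboolP ha ht] [/jinj -> // /IHt ->].
have [ltS ltS_ini] := initial_well_order_ex [set: S].
(* [mu tau n] numbers the task of putting one point of column [n] of [node z tau] into the new set
   over [tau]. Through [d], the same [n] prescribes the label of the point and its new column. *)
pose mu tau n := c (code tau, n).
have muP tau tau' n n' : below th tau -> below th tau' -> mu tau n = mu tau' n' ->
    tau = tau' /\ n = n'.
  by move=> bt bt' /cinj[/codeP -> // ->].
pose T m := [set y | forall tau n, below th tau -> mu tau n = m ->
  [/\ node z tau y, (d y).1 = (d n).1 & column z tau y = n]].
(* Task [m] avoids only obstacles numbered at most [m]. These are few, and each obstacle is
   neglected by fewer than |S| tasks. [Av1] serves the fourth and fifth clauses, [Av2] the fifth. *)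
pose Av1 tau n m := [set y | exists a, [/\ lt a th, ~ ltS m (j a), a \notin tau &
  [/\ trace z a y, node z tau y & column z tau y = n]]].
pose Av2 (tau : seq I) m := [set y | exists tau' i a,
  [/\ below th tau', ~ ltS m (code tau'), ~ ltS m i, a \in tau /\ a \notin tau' &
  [/\ trace z a y, node z tau' y & column z tau' y = i]]].
pose Av m := [set y | exists tau n, [/\ below th tau, mu tau n = m &
  Av1 tau n m y \/ Av2 tau m y]].
have T_large m : ~ small S (T m).
  have [[tau [n [bt mE]]]|nm] := pselect (exists tau n, below th tau /\ mu tau n = m).
    refine (contra_not _ (@large_node tau (d n).1 n bt)); apply: small_sub => y [ny dy cy].
    by move=> tau' n'; rewrite -mE => bt' /(muP _ _ _ _ bt' bt)[-> ->].
  move=> /(_ (subset_card_le _)); apply => y _ tau n bt mE.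
  by exfalso; apply: nm; exists tau, n.
have Av_small m : small S (Av m).
  have [[tau [n [bt mE]]]|nm] := pselect (exists tau n, below th tau /\ mu tau n = m);
    last first.
    apply: (@small_sub _ _ _ set0); last by apply: small_finite => //; exact: finite_set0.
    by move=> y [tau [n [bt mE _]]]; apply: nm; exists tau, n.
  apply: (@small_sub _ _ _ (Av1 tau n m `|` Av2 tau m)).
    move=> y [t [k [bt' mE' h]]].
    by have [<- <-] := muP _ _ _ _ bt' bt (etrans mE' (esym mE)).
  apply: smallU => //.
    apply: (@small_sub _ _ _ (\bigcup_(a in [set a | [/\ lt a th, ~ ltS m (j a) & a \notin tau]])
      [set y | [/\ trace z a y, node z tau y & column z tau y = n]])).
      by move=> y [a [ath ma nat h]]; exists a.
    apply: small_bigcup => // [|a [ath _ nat]]; last exact: small_trace_node.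
    apply: (@small_preimage _ _ _ j _ _ _ _ (small_le_preds S_regular (x := m) ltS_ini)).
      by move=> a [].
    by move=> a b [ath _ _] [bth _ _]; exact: jinj.
  apply: (@small_sub _ _ _ (\bigcup_(tau' in [set t | below th t /\ ~ ltS m (code t)])
     \bigcup_(i in [set i | ~ ltS m i]) \bigcup_(a in [set a | a \in tau])
      [set y | [/\ a \notin tau', trace z a y, node z tau' y & column z tau' y = i]])).
    move=> y [t [i [a [bt' mt mi [at' nat] [h1 h2 h3]]]]].
    by exists t => //; exists i => //; exists a.
  apply: small_bigcup2 => //; [|exact: small_le_preds|].
    apply: (@small_preimage _ _ _ code _ _ _ _ (small_le_preds S_regular (x := m) ltS_ini)).
      by move=> t [].
    by move=> t t' [bt' _] [bt'' _]; exact: codeP.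
  move=> t i [bt' _] _; apply: small_bigcup => // [|a at']; first exact: small_seq.
  have [nat|nat] := boolP (a \in t).
    apply: (@small_sub _ _ _ set0); last by apply: small_finite => //; exact: finite_set0.
    by move=> y [/negP].
  apply: small_sub (@small_trace_node t a i bt' (below_mem bt at') nat).
  by move=> y [].
have [y yinj yP] := injective_choice S_regular T_large Av_small.
have /choice[col colP] : forall s, exists i, forall tau n, below th tau ->
    s = y (mu tau n) -> i = (d n).2.
  move=> s; have [[tau [n [bt sE]]]|ns] := pselect (exists tau n, below th tau /\ s = y (mu tau n)).
    exists (d n).2 => tau' n' bt'; rewrite sE => /yinj /muP[] // _ -> //.
  by exists x0 => tau n bt sE; exfalso; apply: ns; exists tau, n.
exists (fun tau => ([set s | exists n, s = y (mu tau n)], col)); split=> /=.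
- move=> tau bt _ [n ->]; have [/(_ tau n bt erefl)[]] := yP (mu tau n).
  by [].
- move=> tau q i bt; refine (contra_not _ (@d_large (q, i))).
  apply: (small_preimage (f := fun n => y (mu tau n))).
    move=> n /= dn; have [/(_ tau n bt erefl)[_ + _] _] := yP (mu tau n).
    by rewrite dn /= => dy; split=> //; [exists n|rewrite (colP _ _ _ bt erefl) dn].
  by move=> n n' _ _ /yinj /muP[].
- by move=> tau tau' _ bt bt' [n ->] [n' /yinj /muP[]].
- move=> a ath; apply: (@small_sub _ _ _ (y @` [set m | ltS m (j a)])); last first.
    by apply: small_image; exact: small_predsT.
  move=> s [tr [tau [bt nat [n sE]]]]; rewrite sE in tr *; exists (mu tau n) => //=.
  have [/(_ tau n bt erefl)[ny _ cy] nav] := yP (mu tau n).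
  apply: contrapT => nlt; apply: nav; exists tau, n; split=> //; left; exists a.
  by split.
- move=> tau i bt.
  (* Over [tau] itself, only task [mu tau i] meets column [i]. If [tau'] differs from [tau], some
     index lies in exactly one of them, and [Av1] or [Av2] excludes all but early tasks. *)
  apply: (@small_sub _ _ _ (y @` ([set mu tau i] `|` [set m | ltS m (code tau)] `|`
    [set m | ltS m i] `|` \bigcup_(a in [set a | a \in tau]) [set m | ltS m (j a)]))).
    move=> s [ny cy [tau' bt' [n yE]]]; rewrite yE in ny cy *; exists (mu tau' n) => //.
    have [/(_ tau' n bt' erefl)[ny' _ cy'] nav] := yP (mu tau' n).
    have [tt|tt] := eqVneq tau' tau.
      by left; left; left; rewrite /= -{}cy -tt cy'.
    apply: contrapT => /not_orP[/not_orP[/not_orP[_ nc] ni] na].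
    apply: nav; exists tau', n; split=> //.
    have [[a at' nat]|ntt] := pselect (exists2 a, a \in tau & a \notin tau').
      left; exists a; split=> //; first exact: below_mem at'.
        by move=> h; apply: na; exists a.
      by split=> //; exact: node_trace ny.
    have [[a at' nat]|ntt'] := pselect (exists2 a, a \in tau' & a \notin tau).
      right; exists tau, i, a; split=> //.
      by split=> //; exact: node_trace ny'.
    exfalso; move/eqP: tt; apply; apply: below_inj bt' bt _ => a.
    apply/idP/idP => ha; apply/negPn/negP => hna; first by apply: ntt'; exists a.
    by apply: ntt; exists a.
  apply: small_image; apply: smallU => //; last first.
    by apply: small_bigcup => // [|a _]; [exact: small_seq|exact: small_predsT].
  apply: smallU => //; last exact: small_predsT.
  by apply: smallU => //; [apply: small_finite => //; exact: finite_set1|exact: small_predsT].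
Qed.

End StageFacts.

(** Largeness for every label allows any finite data to be realised inside any node. The last two
    clauses recover, for almost all points common to two levels, the list below the smaller
    index. *)
Theorem tree_of_sets : exists Z : seq I -> set S,
  [/\ forall th tau, below th tau -> Z (th :: tau) `<=` Z tau,
      forall tau q, sorted gtb tau -> ~ small S [set y | Z tau y /\ (d y).1 = q],
      forall th tau tau' y, below th tau -> below th tau' ->
        Z (th :: tau) y -> Z (th :: tau') y -> tau = tau' &
      forall a th, lt a th -> small S [set y | exists tau tau',
        [/\ below th tau, below a tau', a \notin tau, Z (th :: tau) y & Z (a :: tau') y]]].
Proof.
have [||z zP] := transfinite_recursion (fun=> (set0, id)) lt_wf (Q := stage).
- by move=> th z z' w; exact: stage_ext.
- by move=> th z IH; exact: stage_ex.
have [x0] := regular_inhabited S_regular.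
exists (node z); split.
- by move=> th tau bt; have [q1 _ _ _ _] := zP th; exact: q1.
- move=> tau q st; have h : ~ small S [set y | [/\ node z tau y, (d y).1 = q & column z tau y = x0]].
    case: tau st => [_|th tau bt]; last by have [_ q2 _ _ _] := zP th; exact: q2.
    refine (contra_not _ (@d_large (q, x0))); apply: small_sub => y /= ->.
    by split.
  by refine (contra_not _ h); apply: small_sub => y [].
- by move=> th tau tau' y; have [_ _ q3 _ _] := zP th; exact: q3.
- move=> a th ath; have [_ _ _ /(_ a ath) q4 _] := zP th; apply: small_sub q4.
  by move=> y [tau [tau' [bt bt' nat zy zy']]]; split; [exists tau'|exists tau].
Qed.

End Tree.

Local Open Scope group_scope.

(** * Blocks and rows *)

(** At stage [y] fewer than |S| equations [g * w = g' * a y'] must fail, and each has fewer than |S|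
    solutions [w]. *)
Lemma disjoint_blocks (S : semigroupType) (G : S -> seq S) :
  regular_card [set: S] -> very_weakly_cancellative S ->
  exists a : S -> S, forall y y' g g', g \in G y -> g' \in G y' ->
    g * a y = g' * a y' -> y = y'.
Proof.
move=> S_regular vwc; have [lt lt_ini] := initial_well_order_ex [set: S].
have [wf _ tot _] := lt_ini; have [x0] := regular_inhabited S_regular.
have [] := @transfinite_recursion S S x0 lt (fun y a w => forall y' g g', lt y' y ->
  g \in G y -> g' \in G y' -> g * w <> g' * a y') wf.
- by move=> y a a' w aa' h y' g g' yy' gy gy'; rewrite -aa' //; exact: h.
- move=> y a _; apply: contrapT => nw.
  suff : small S [set: S] by apply; exact: card_lexx.
  apply: (@small_sub _ _ _ (\bigcup_(y' in [set y' | lt y' y]) \bigcup_(g in [set g | g \in G y])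
    \bigcup_(g' in [set g' | g' \in G y']) (fun x => g * x) @^-1` [set g' * a y'])).
    move=> w _; apply: contrapT => nin; apply: nw; exists w => y' g g' yy' gy gy' e.
    by apply: nin; exists y' => //; exists g => //; exists g'.
  apply: small_bigcup => // [|y' yy']; first exact: small_predsT.
  apply: small_bigcup => // [|g gy]; first exact: small_seq.
  apply: small_bigcup => // [|g' gy']; first exact: small_seq.
  by have [[_ ?] _] := vwc g (g' * a y').
move=> a aP; exists a => y y' g g' gy gy' e; have [yy'|[//|y'y]] := tot y y' I I; exfalso.
- by apply: (aP y' y g' g) => //; rewrite e.
- exact: (aP y y' g g') e.
Qed.

Lemma mem_split (T : eqType) (x : T) s : x \in s -> exists s1 s2, s = s1 ++ x :: s2.
Proof. by case/splitPr => s1 s2; exists s1, s2. Qed.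

Lemma cat_cons_inj (T : eqType) (x x' : T) (s1 s2 s1' s2' : seq T) :
  s1 ++ x :: s2 = s1' ++ x' :: s2' -> size s2 = size s2' -> x = x'.
Proof.
move=> E sz; have : size s1 = size s1'.
  by move/(congr1 size): E; rewrite !size_cat /= sz => /eqP; rewrite eqn_add2r => /eqP.
by move=> sz1; move/eqP: E; rewrite eqseq_cat // => /andP[_ /eqP[]].
Qed.

Section Rows.
Variable S : Type.

Definition lookup (l : seq (seq bool * seq nat)) (k : seq bool) : seq nat :=
  head [::] [seq p.2 | p <- l & p.1 == k].

Definition signature (t : set S) (s : seq S) : seq bool := [seq `[< t x >] | x <- s].

Lemma lookup_uniq l k v : (k, v) \in l -> (forall v', (k, v') \in l -> v' = v) ->
  lookup l k = v.
Proof.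
rewrite /lookup => kvl h; case E : [seq p <- l | p.1 == k] => [|[k' v'] l'] /=.
  have : (k, v) \in [seq p <- l | p.1 == k] by rewrite mem_filter eqxx.
  by rewrite E.
have : (k', v') \in [seq p <- l | p.1 == k] by rewrite E mem_head.
by rewrite mem_filter /= => /andP[/eqP -> /h].
Qed.

(** Finitely many distinct sets have distinct traces on some finite [s], so a table keyed by traces
    prescribes arbitrary values, as in Hausdorff's independent families. *)
Lemma independent_rows (ts : seq (set S)) (w : set S -> seq nat) :
  exists s l, forall t, t \in ts -> lookup l (signature t s) = w t.
Proof.
have [s sP] : exists s, forall t t', t \in ts -> t' \in ts -> signature t s = signature t' s -> t = t'.
  have [s sP] : exists s : seq S, forall p, p \in [seq (t, t') | t <- ts, t' <- ts] ->
      signature p.1 s = signature p.2 s -> p.1 = p.2.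
    elim: [seq (t, t') | t <- ts, t' <- ts] => [|[t t'] ps [s sP]]; first by exists [::].
    have [<-|/eqP tt'] := eqVneq t t'.
      by exists s => p; rewrite inE => /orP[/eqP -> //|]; exact: sP.
    have [x nx] : exists x, `[< t x >] <> `[< t' x >].
      apply: contrapT => nx; apply: tt'; apply/seteqP; split=> x.
        move=> tx; apply: contrapT => ntx; apply: nx; exists x.
        by rewrite (asboolT tx) (asboolF ntx).
      move=> tx; apply: contrapT => ntx; apply: nx; exists x.
      by rewrite (asboolT tx) (asboolF ntx).
    exists (x :: s) => p; rewrite inE => /orP[/eqP -> [] //|pps [_]]; exact: sP.
  exists s => t t' tts t'ts; apply: (sP (t, t')).
  by apply/allpairsP; exists (t, t').
exists s, [seq (signature t s, w t) | t <- ts] => t tts; apply: lookup_uniq.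
  by apply/mapP; exists t.
by move=> v /mapP[t' t'ts [e ->]]; rewrite (sP t t').
Qed.

End Rows.

(** * The generic filter *)

Section Construction.
Variables (S : semigroupType) (I : eqType) (lt : I -> I -> Prop).
Hypothesis S_regular : regular_card [set: S].
Hypothesis S_vwc : very_weakly_cancellative S.
Hypothesis lt_wo : strict_well_order lt.

(** The components are a sample list and a table, which determine every row at a point, and the
    multipliers of its block. *)
Definition label : Type := seq S * seq (seq bool * seq nat) * seq S.

Variables (d : S -> label) (a : S -> S) (Z : seq I -> set S).

Hypothesis a_block : forall y y' g g', g \in (d y).2 -> g' \in (d y').2 ->
  g * a y = g' * a y' -> y = y'.
Hypothesis Z_sub : forall th tau, below lt th tau -> Z (th :: tau) `<=` Z tau.
Hypothesis Z_large : forall tau q, sorted (gtb lt) tau ->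
  ~ small S [set y | Z tau y /\ d y = q].
Hypothesis Z_disjoint : forall th tau tau' y, below lt th tau -> below lt th tau' ->
  Z (th :: tau) y -> Z (th :: tau') y -> tau = tau'.
Hypothesis Z_small : forall al th, lt al th -> small S [set y | exists tau tau',
  [/\ below lt th tau, below lt al tau', al \notin tau, Z (th :: tau) y & Z (al :: tau') y]].

Definition block (y : S) : set S := [set b | exists2 g, g \in (d y).2 & b = g * a y].

Definition row (t : set S) (y : S) : seq nat := lookup (d y).1.2 (signature t (d y).1.1).

(** Here translation by [s] stays in one block, hence keeps the base point [y] with its rows and
    nodes; this reconciles invariance with independence. *)
Definition same_block (s : S) : set S := [set b | exists2 y, block y b & block y (s * b)].

Definition translate (s : S) (A : set S) : set S := [set b | A (s * b)].

Lemma block_inj y y' b : block y b -> block y' b -> y = y'.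
Proof. by move=> [g gy ->] [g' gy']; exact: a_block. Qed.

Lemma small_block y : small S (block y).
Proof.
apply: (@small_sub _ _ _ ((fun g => g * a y) @` [set g | g \in (d y).2])).
  by move=> _ [g gy ->]; exists g.
by apply: small_image; exact: small_seq.
Qed.

Lemma small_translate s A : small S A -> small S (translate s A).
Proof.
move=> sA; apply: (@small_sub _ _ _ (\bigcup_(t in A) (fun x => s * x) @^-1` [set t])).
  by move=> b /= Ab; exists (s * b).
by apply: small_bigcup => // t _; have [[_ ?] _] := S_vwc s t.
Qed.

Record invariant_filter (F : set (set S)) : Prop := InvariantFilter {
  inv_setT : F setT;
  inv_sub : forall A B : set S, A `<=` B -> F A -> F B;
  inv_setI : forall A B : set S, F A -> F B -> F (A `&` B);
  inv_translate : forall s A, F A -> F (translate s A);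
  inv_cosmall : forall A, small S (~` A) -> F A;
  inv_block : forall s, F (same_block s)
}.

(* Independence on B of the rows outside R.  The values w are prescribed after
   tau, so that they may refer to the positions of indices in tau. *)
Definition meets (R : set (set S)) (B : set S) : Prop :=
  forall (tau0 : seq I) (ts : seq (set S)), (forall t, t \in ts -> ~ R t) ->
    exists tau, [/\ sorted (gtb lt) tau, {subset tau0 <= tau} & forall w : set S -> seq nat,
      exists b y, [/\ B b, block y b, Z tau y & forall t, t \in ts -> row t y = w t]].

Definition good (F R : set (set S)) : Prop :=
  invariant_filter F /\ forall B, F B -> meets R B.

Definition orbit_inter (As : seq (set S)) (ss : seq S) : set S :=
  [set b | forall A, A \in As -> A b /\ forall s, s \in ss -> A (s * b)].

(** For an invariant filter [F], this is the possibly improper invariant filter generated by [F] and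
    [AA]. *)
Definition extend (F AA : set (set S)) : set (set S) :=
  [set A | exists B As ss, [/\ F B, forall A, A \in As -> AA A &
    B `&` orbit_inter As ss `<=` A]].

Lemma meets_sub R R' B B' : R `<=` R' -> B `<=` B' -> meets R B -> meets R' B'.
Proof.
move=> RR' BB' mB tau0 ts tsR; have [|tau [st tt h]] := mB tau0 ts.
  by move=> t /tsR + /RR'.
exists tau; split=> // w; have [b [y [Bb by_ Zy yw]]] := h w.
by exists b, y; split=> //; exact: BB'.
Qed.

Lemma sub_extend F AA : F `<=` extend F AA.
Proof. by move=> A FA; exists A, [::], [::]; split=> // b []. Qed.

Lemma extend_mem F AA A : F setT -> AA A -> extend F AA A.
Proof.
move=> FT AAA; exists setT, [:: A], [::]; split=> //.
  by move=> A'; rewrite inE => /eqP ->.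
by move=> b [_ /(_ A)]; rewrite inE eqxx => /(_ isT)[].
Qed.

Lemma good_extend F AA R R' : good F R ->
  (forall B As ss, F B -> (forall A, A \in As -> AA A) -> meets R' (B `&` orbit_inter As ss)) ->
  good (extend F AA) R'.
Proof.
move=> [[FT FS FI Ft Fc Fb] _] fip; split; last first.
  by move=> A [B [As [ss [FB AsA BA]]]]; apply: (meets_sub _ BA) (fip _ _ _ FB AsA).
split.
- exact: sub_extend.
- move=> A A' AA' [B [As [ss [FB AsA BA]]]]; exists B, As, ss; split=> //.
  exact: subset_trans AA'.
- move=> A A' [B [As [ss [FB AsA BA]]]] [B' [As' [ss' [FB' AsA' BA']]]].
  exists (B `&` B'), (As ++ As'), (ss ++ ss'); split; first exact: FI.
    by move=> C; rewrite mem_cat => /orP[/AsA|/AsA'].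
  move=> b [[Bb B'b] ob]; split; [apply: BA|apply: BA']; split=> // C CA.
    have [|Cb Cs] := ob C; first by rewrite mem_cat CA.
    by split=> // s ss_s; apply: Cs; rewrite mem_cat ss_s.
  have [|Cb Cs] := ob C; first by rewrite mem_cat CA orbT.
  by split=> // s ss_s; apply: Cs; rewrite mem_cat ss_s orbT.
- move=> s A [B [As [ss [FB AsA BA]]]].
  exists (translate s B), As, (s :: [seq s' * s | s' <- ss]); split=> //; first exact: Ft.
  move=> b [Bb ob]; apply: BA; split=> // C CA; have [Cb Cs] := ob C CA.
  split=> [|s' ss']; first by apply: Cs; exact: mem_head.
  by rewrite mulgA; apply: Cs; rewrite inE (map_f (fun s' => s' * s)) ?orbT.
- by move=> A sA; apply: sub_extend; exact: Fc.
- by move=> s; apply: sub_extend; exact: Fb.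
Qed.

Lemma good_initial : exists F, good F set0.
Proof.
pose inter_block (ss : seq S) := [set b | forall s, s \in ss -> same_block s b].
exists [set A | exists ss C, small S C /\ inter_block ss `\` C `<=` A].
have small0 : small S (set0 : set S).
  by apply: small_finite => //; exact: finite_set0.
split; [split|].
- by exists [::], set0; split=> //; exact: small0.
- move=> A B AB [ss [C [sC CA]]]; exists ss, C; split=> //; exact: subset_trans AB.
- move=> A A' [ss [C [sC CA]]] [ss' [C' [sC' CA']]].
  exists (ss ++ ss'), (C `|` C'); split; first exact: smallU.
  move=> b [bs /not_orP[nC nC']]; split; [apply: CA|apply: CA']; split=> // s ins.
    by apply: bs; rewrite mem_cat ins.
  by apply: bs; rewrite mem_cat ins orbT.
- move=> s A [ss [C [sC CA]]].
  exists (s :: [seq s' * s | s' <- ss]), (translate s C); split; first exact: small_translate.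
  move=> b [bs nC]; apply: CA; split=> // s' ss'.
  have [y yb ysb] := bs s (mem_head _ _).
  have [|y' yb' ysb'] := bs (s' * s); first by rewrite inE (map_f (fun s' => s' * s)) ?orbT.
  by exists y => //; rewrite mulgA (block_inj yb yb').
- by move=> A sA; exists [::], (~` A); split=> // b [_ /contrapT].
- move=> s; exists [:: s], set0; split; first exact: small0.
  by move=> b [bs _]; apply: bs; exact: mem_head.
move=> A [ss [C [sC CA]]] tau0 ts _.
have [lt_wf lt_tr lt_tot] := lt_wo.
pose leb x y := `[< x = y \/ lt y x >].
have leb_total : total leb.
  move=> x y; apply/orP; have [h|[->|h]] := lt_tot x y.
  - by right; apply/asboolP; right.
  - by left; apply/asboolP; left.
  - by left; apply/asboolP; right.
have leb_trans : transitive leb.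
  move=> y x z /asboolP[->//|yx] /asboolP[<-|zy]; apply/asboolP; right=> //.
  exact: lt_tr yx.
pose tau := sort leb (undup tau0).
have tau_sorted : sorted (gtb lt) tau.
  have : sorted leb tau by exact: sort_sorted.
  have : uniq tau by rewrite sort_uniq undup_uniq.
  rewrite !sorted_pairwise // ?uniq_pairwise; last first.
    by move=> y x z /asboolP yx /asboolP zy; apply/asboolP; exact: lt_tr yx.
  elim: (tau) => //= x t IHt /andP[/allP ux ut] /andP[/allP lx lt'].
  rewrite IHt // andbT; apply/allP => y yt; apply/asboolP.
  by have /asboolP[xy|//] := lx y yt; have := ux y yt; rewrite /= xy eqxx.
exists tau; split=> // [x|w]; first by rewrite mem_sort mem_undup.
have [s [l sl]] := independent_rows ts w; have [g] := regular_inhabited S_regular.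
(* The label requests the prescribed rows and a block containing [g * a y] with its translates by
   [ss]. *)
pose q : label := (s, l, g :: [seq s' * g | s' <- ss]).
have block_mem y h : h \in q.2 -> d y = q -> block y (h * a y).
  by move=> hq dy; exists h => //; rewrite dy.
have gq : g \in q.2 by exact: mem_head.
(* Disjoint blocks make the points [g * a y] distinct, so the |S| many points labelled [q] cannot
   all lead into the small set [C]. *)
have [y [[Zy dy] nCy]] : exists y, (Z tau y /\ d y = q) /\ ~ C (g * a y).
  apply: contrapT => ny; apply: (@Z_large tau q tau_sorted).
  apply: (small_preimage (f := fun y => g * a y)) sC => [y Zy|y y' [_ dy] [_ dy'] e].
    by apply: contrapT => nC; apply: ny; exists y.
  by apply: a_block e; rewrite (dy, dy').
exists (g * a y), y; split=> //; last 2 first.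
- exact: block_mem.
- by move=> t tts; rewrite /row dy /= sl.
apply: CA; split=> // s' ss'; exists y; first exact: block_mem.
by rewrite mulgA; apply: block_mem => //; rewrite inE (map_f (fun s' => s' * g)) ?orbT.
Qed.

(** Constant [U] yields maximality of [F]. When all [U eta] lie in a proper invariant [F], the first
    alternative is impossible and the sets [V] are obtained. *)
Definition outcome (e : I -> I -> S) (U : S -> set S) (F : set (set S)) : Prop :=
  (exists etas ss, F (~` orbit_inter [seq U eta | eta <- etas] ss)) \/
  (forall eta, F (U eta)) /\ exists2 V : I -> set S, forall th, F (V th) &
    forall al th, lt al th -> small S (V al `&` V th `\` U (e al th)).

Lemma outcome_sub e U F F' : F `<=` F' -> outcome e U F -> outcome e U F'.
Proof.
move=> FF' [[etas [ss /FF' h]]|[FU [V FV Vs]]]; first by left; exists etas, ss.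
by right; split=> [eta|]; [exact: FF'|exists V => // th; exact: FF'].
Qed.

Lemma below_suffix th tau1 al tau2 : below lt th (tau1 ++ al :: tau2) -> below lt al tau2.
Proof. by rewrite /below cat_path /= => /and3P[]. Qed.

Lemma sorted_suffix tau1 al tau2 : sorted (gtb lt) (tau1 ++ al :: tau2) -> below lt al tau2.
Proof. by case: tau1 => //= b tau1; exact: below_suffix. Qed.

Lemma Z_suffix tau1 tau2 : sorted (gtb lt) (tau1 ++ tau2) -> Z (tau1 ++ tau2) `<=` Z tau2.
Proof.
elim: tau1 => [|b tau1 IH] st /=; first exact: subset_refl.
apply: subset_trans (Z_sub st) (IH _).
exact: path_sorted st.
Qed.

Section Linked.
Variables (e : I -> I -> S) (U : S -> set S) (t : set S).

(* The row t selects positions in the chain of indices th :: tau of a point y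
   (lists are decreasing, so the position of an index is the length of the list
   after it).  Only the finitely many selected al impose a condition on b, which
   keeps these sets compatible with the filter. *)
Definition linked th : set S := [set b | exists y tau,
  [/\ block y b, below lt th tau, Z (th :: tau) y, size tau \in row t y &
      forall al tau1 tau2, tau = tau1 ++ al :: tau2 -> size tau2 \in row t y ->
        U (e al th) b]].

(** Both memberships of [b] concern one base point [y]. If [al] is not in the list of [th], then [y]
    lies in a small set; otherwise disjointness identifies the tail after [al] with [tau'], so its
    length is selected and [U (e al th)] holds at [b]. *)
Lemma small_linked al th : lt al th ->
  small S (linked al `&` linked th `\` U (e al th)).
Proof.
move=> lath; have := Z_small lath; set Y := [set y | _] => sY.
apply: (@small_sub _ _ _ (\bigcup_(y in Y) block y)); last first.
  by apply: small_bigcup => // y _; exact: small_block.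
move=> b [[[y [tau' [by_ ba' Zy' row' _]]] [y' [tau [by' ba Zy row_ h]]]] nU].
have yy' := block_inj by_ by'; subst y'; exists y => //; exists tau, tau'; split=> //.
apply/negP => altau; apply: nU; move: ba Zy row_ h.
case/splitPr: altau => tau1 tau2 ba Zy row_ h.
have st : sorted (gtb lt) (th :: tau1 ++ al :: tau2) by [].
have Zy2 : Z (al :: tau2) y by exact: (@Z_suffix (th :: tau1)) Zy.
apply: (h al tau1 tau2) => //.
by rewrite (Z_disjoint (below_suffix ba) ba' Zy2 Zy').
Qed.

End Linked.

(* If the sets U eta cannot all be added, this is witnessed by values rho tau of
   finitely many rows ts; fixing these rows puts the complement of some
   intersection of translates of the U eta into the filter. *)
Lemma good_step F R e U t : good F R -> ~ R t ->
  exists F' ts, [/\ good F' (R `|` [set` ts : seq (set S)]), F `<=` F' & outcome e U F'].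
Proof.
move=> gF nRt; have [iF mF] := gF.
have [ok|nok] := pselect (forall B etas ss, F B ->
    meets R (B `&` orbit_inter [seq U eta | eta <- etas] ss)).
  pose AA := [set A | (exists th, A = linked e U t th) \/ exists eta, A = U eta].
  exists (extend F AA), [:: t]; split; last 2 first.
  - exact: sub_extend.
  - right; split=> [eta|]; first by apply: extend_mem; [exact: inv_setT|right; exists eta].
    exists (linked e U t) => [th|al th]; last exact: small_linked.
    by apply: extend_mem; [exact: inv_setT|left; exists th].
  apply: (good_extend gF) => B As ss FB AsA.
  have [sig [etas As_sub]] : exists (sig : seq I) (etas : seq S), forall A, A \in As ->
      (exists2 th, th \in sig & A = linked e U t th) \/ (exists2 eta, eta \in etas & A = U eta).
    elim: As AsA => [|A As IH] AsA; first by exists [::], [::].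
    have [|sig [etas h]] := IH; first by move=> A' A's; apply: AsA; rewrite inE A's orbT.
    have [|[th AE]|[eta AE]] := AsA A; first exact: mem_head.
      exists (th :: sig), etas => A'; rewrite inE => /orP[/eqP ->|/h[[th' th's ->]|]].
      - by left; exists th => //; exact: mem_head.
      - by left; exists th' => //; rewrite inE th's orbT.
      - by right.
    exists sig, (eta :: etas) => A'; rewrite inE => /orP[/eqP ->|/h[|[eta' eta's ->]]].
    - by right; exists eta => //; exact: mem_head.
    - by left.
    - by right; exists eta' => //; rewrite inE eta's orbT.
  (* Intersecting with these sets keeps the translates of [b] in its block, where [linked] is
     verified with the same [y]. *)
  have FB' : F (B `&` [set b | forall s, s \in ss -> same_block s b]).
    apply: inv_setI => //; elim: (ss) => [|s ss' IH].
      by apply: inv_sub (inv_setT iF) => // b _ s; rewrite in_nil.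
    apply: inv_sub (inv_setI iF (inv_block iF s) IH) => // b [bs bss] s'.
    by rewrite inE => /orP[/eqP ->|/bss].
  pose etas' := etas ++ [seq e al th | al <- sig, th <- sig].
  move=> tau0 ts tsR.
  have [|tau [st tau_sub h]] := ok _ etas' ss FB' (tau0 ++ sig) (t :: ts).
    move=> t'; rewrite inE => /orP[/eqP -> //|/tsR ntR Rt'].
    by apply: ntR; left.
  exists tau; split=> // [x xtau|w]; first by apply: tau_sub; rewrite mem_cat xtau.
  (* [index] counts from the front, whereas a position is the length of the list after [al]. *)
  pose pos al := (size tau - (index al tau).+1)%N.
  have posE al tau1 tau2 : tau = tau1 ++ al :: tau2 -> pos al = size tau2.
    move=> tauE; have : uniq tau.
      apply: sorted_uniq st; first exact: gtb_trans.
      by move=> x; apply/asboolP; exact: lt_irr.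
    rewrite /pos tauE uniq_catC cat_uniq /= => /and3P[/andP[_ _] /hasPn al1 _].
    rewrite index_cat; case: ifP => [al_1|_].
      by have := al1 _ al_1; rewrite /= mem_head.
    by rewrite /= eqxx addn0 size_cat /= addnS subSS addKn.
  (* The free row [t] is set to select exactly the indices in [sig]; [etas'] contains all values of
     [e] on them. *)
  have [b [y [[[Bb sb] ob] by_ Zy yw]]] := h (fun t' => if t' == t then [seq pos al | al <- sig] else w t').
  have rowt : row t y = [seq pos al | al <- sig] by rewrite yw ?mem_head ?eqxx.
  have obU eta : eta \in etas' -> U eta b /\ forall s, s \in ss -> U eta (s * b).
    by move=> etas_eta; apply: ob; rewrite map_f.
  have e_mem al th : al \in sig -> th \in sig -> e al th \in etas'.
    by move=> als ths; rewrite mem_cat; apply/orP; right; apply/allpairsP; exists (al, th).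
  have sig_linked th c : th \in sig -> block y c ->
      (forall eta, eta \in etas' -> U eta c) -> linked e U t th c.
    move=> ths yc Uc; have : th \in tau by apply: tau_sub; rewrite mem_cat ths orbT.
    move=> /mem_split[tau1 [tau2 tauE]].
    exists y, tau2; split=> //.
    - by move: st; rewrite tauE; exact: sorted_suffix.
    - by apply: (@Z_suffix tau1); rewrite -tauE.
    - by rewrite rowt -(posE th tau1 tau2) // map_f.
    move=> al tau1' tau2' tau2E; rewrite rowt => /mapP[al' als' pos'].
    have altau' : al' \in tau by apply: tau_sub; rewrite mem_cat als' orbT.
    have [tau3 [tau4 tauE']] := mem_split altau'.
    suff -> : al = al' by apply: Uc; exact: e_mem.
    apply: (@cat_cons_inj _ _ _ (tau1 ++ th :: tau1') tau2' tau3 tau4).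
      by rewrite -tauE' tauE tau2E -catA.
    by rewrite -(posE _ _ _ tauE') pos'.
  exists b, y; split=> //.
    split=> // A AAs; have [[th ths ->]|[eta etas_eta ->]] := As_sub A AAs.
      split=> [|s ss_s].
        by apply: sig_linked => // eta /obU[].
      apply: sig_linked => // [|eta /obU[_ /(_ s ss_s)]//].
      by have [y' yb' ysb'] := sb s ss_s; rewrite (block_inj by_ yb').
    by apply: obU; rewrite mem_cat etas_eta.
  move=> t' t'ts; rewrite yw ?inE ?t'ts ?orbT //.
  have [tE|//] := eqVneq t' t; by case: (tsR t' t'ts); right; rewrite /= tE mem_head.
have [B [etas [ss [FB nm]]]] : exists B etas ss,
    F B /\ ~ meets R (B `&` orbit_inter [seq U eta | eta <- etas] ss).
  apply: contrapT => h; apply: nok => B etas ss FB; apply: contrapT => nm.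
  by apply: h; exists B, etas, ss.
set O := orbit_inter _ ss in nm.
have [tau0 [ts [tsR nm']]] : exists (tau0 : seq I) (ts : seq (set S)),
    (forall t, t \in ts -> ~ R t) /\ forall tau, exists w : set S -> seq nat,
    sorted (gtb lt) tau -> {subset tau0 <= tau} -> forall b y, (B `&` O) b -> block y b ->
      Z tau y -> ~ forall t, t \in ts -> row t y = w t.
  apply: contrapT => h; apply: nm => tau0 ts tsR; apply: contrapT => h'.
  apply: h; exists tau0, ts; split=> // tau; apply: contrapT => h2; apply: h'.
  exists tau; split.
  - by apply: contrapT => nst; apply: h2; exists (fun=> [::]).
  - by apply: contrapT => nst; apply: h2; exists (fun=> [::]).
  move=> w; apply: contrapT => h3; apply: h2; exists w => st tt b y BO yb Zy rw.
  by apply: h3; exists b, y.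
have /choice[rho rhoP] := nm'.
pose Q := [set b | exists y tau, [/\ block y b, sorted (gtb lt) tau, {subset tau0 <= tau},
  Z tau y & forall t, t \in ts -> row t y = rho tau t]].
exists (extend F [set Q]), ts; split; last 2 first.
- exact: sub_extend.
- left; exists etas, ss; exists B, [:: Q], [::]; split=> //.
    by move=> A; rewrite inE => /eqP ->.
  move=> b [Bb /(_ Q)]; rewrite mem_head => /(_ isT)[[y [tau [yb st tt Zy rw]]] _] Ob.
  exact: (rhoP tau st tt b y).
apply: (good_extend gF) => B' As ss' FB' AsQ tau0' ts' ts'R.
have FB2 : F (B' `&` [set b | forall s, s \in ss' -> same_block s b]).
  apply: inv_setI => //; elim: (ss') => [|s ss'' IH].
    by apply: inv_sub (inv_setT iF) => // b _ s; rewrite in_nil.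
  apply: inv_sub (inv_setI iF (inv_block iF s) IH) => // b [bs bss] s'.
  by rewrite inE => /orP[/eqP ->|/bss].
have [|tau [st tau_sub h]] := mF _ FB2 (tau0 ++ tau0') (ts ++ ts').
  by move=> t'; rewrite mem_cat => /orP[/tsR //|/ts'R nR Rt']; apply: nR; left.
exists tau; split=> // [x xt|w]; first by apply: tau_sub; rewrite mem_cat xt orbT.
have [b [y [[B'b sb] yb Zy rw]]] := h (fun t' => if t' \in ts then rho tau t' else w t').
exists b, y; split=> //; last first.
  move=> t' t'ts; rewrite rw ?mem_cat ?t'ts ?orbT //; case: ifP => // tts.
  by case: (ts'R t' t'ts); right.
have Qc c : block y c -> Q c.
  move=> yc; exists y, tau; split=> // [x xt|t' tts].
    by apply: tau_sub; rewrite mem_cat xt.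
  by rewrite rw ?mem_cat ?tts.
split=> // A /AsQ ->; split=> [|s ss_s]; first exact: Qc.
by apply: Qc; have [y' yb' ysb'] := sb s ss_s; rewrite (block_inj yb yb').
Qed.

Lemma good_sub F R R' : R `<=` R' -> good F R -> good F R'.
Proof. by move=> RR' [iF mF]; split=> // B /mF; exact: meets_sub. Qed.

Lemma good_union (GG : set (set (set S))) R : GG !=set0 ->
  (forall F F', GG F -> GG F' -> F `<=` F' \/ F' `<=` F) ->
  (forall F, GG F -> good F R) -> good (\bigcup_(F in GG) F) R.
Proof.
move=> [F0 GF0] tot gG; split=> [|B [F GF FB]]; last by have [_] := gG F GF; exact.
have [iF0 _] := gG F0 GF0; split.
- by exists F0 => //; exact: inv_setT.
- move=> A B AB [F GF FA]; exists F => //; have [iF _] := gG F GF.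
  exact: inv_sub iF _ _ AB FA.
- move=> A B [F GF FA] [F' GF' F'B].
  have [FF'|F'F] := tot F F' GF GF'.
    by exists F' => //; have [iF _] := gG F' GF'; apply: inv_setI => //; exact: FF'.
  by exists F => //; have [iF _] := gG F GF; apply: inv_setI => //; exact: F'F.
- move=> s A [F GF FA]; exists F => //; have [iF _] := gG F GF; exact: inv_translate.
- by move=> A sA; exists F0 => //; exact: inv_cosmall.
- by move=> s; exists F0 => //; exact: inv_block.
Qed.

(* Each of the 2^kappa tasks (C, U) consumes finitely many of the 2^kappa rows,
   so an unused row is available at every stage of a recursion along an initial
   well-order of the tasks. *)
Theorem generic_filter_ex (e : set S -> I -> I -> S) :
  exists F, [/\ invariant_filter F, forall B, F B -> B !=set0 &
    forall C U, outcome (e C) U F].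
Proof.
have [c cinj] := pair_code_ex S_regular; have [k kinj] := nat_code_ex S_regular.
have [F0 gF0] := good_initial.
(* One subset of [S] codes a sequence of subsets; slices 0 and 1 store [C] and [U], so tasks are
   indexed by subsets. *)
pose comp n (X : set S) : set S := [set x | X (c (k n, x))].
pose task_set (X : set S) := comp 0%N X.
pose task_seq (X : set S) eta := [set b | comp 1%N X (c (eta, b))].
have task_ex C U : exists X, task_set X = C /\ task_seq X = U.
  exists [set z | (exists2 x, z = c (k 0%N, x) & C x) \/
    exists eta b, z = c (k 1%N, c (eta, b)) /\ U eta b].
  split.
    apply/seteqP; split=> x.
      by move=> [[x' /cinj[->]]//|[eta [b [/cinj[/kinj]]]]].
    by move=> Cx; left; exists x.
  apply/funext => eta; apply/seteqP; split=> b.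
    move=> [[x' /cinj[/kinj]]//|[eta' [b' [/cinj[/cinj[-> ->]]]]]].
    by [].
  by move=> Ub; right; exists eta, b.
have [lt' [wf' tr' tot' ini']] := initial_well_order_ex [set: set S].
pose used (g : set S -> set (set S) * seq (set S)) (X : set S) : set (set S) :=
  [set t | exists2 Y, lt' Y X & t \in (g Y).2].
have fresh g X : exists t, ~ used g X t.
  (* Diagonalise by slices: slice [n] of the new row differs from slice [n] of the row at index [n]
     of every earlier list. Such a slice exists because fewer than 2^|S| stages precede [X]. *)
  have /choice[T TP] : forall n, exists t, forall Y, lt' Y X ->
      comp n (nth set0 (g Y).2 n) <> t.
    move=> n; apply: contrapT => nt; apply: (ini' X Logic.I).
    apply: (@card_le_of_surj _ _ _ _ (fun Y => comp n (nth set0 (g Y).2 n))) => t _.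
    apply: contrapT => nY; apply: nt; exists t => Y YX e'; apply: nY.
    by exists Y.
  exists [set z | exists n x, z = c (k n, x) /\ T n x] => -[Y YX tg].
  set t := [set _ | _] in tg; apply: (TP (index t (g Y).2) Y YX).
  rewrite nth_index //; apply/seteqP; split=> x.
    by move=> [n [x' [/cinj[/kinj <- <-]]]].
  by move=> Tx; exists (index t (g Y).2), x.
have [||g gP] := @transfinite_recursion (set S) (set (set S) * seq (set S)) (F0, [::]) lt'
  (fun X g w => [/\ F0 `<=` w.1, forall Y, lt' Y X -> (g Y).1 `<=` w.1,
    good w.1 (used g X `|` [set` w.2]) & outcome (e (task_set X)) (task_seq X) w.1]) wf'.
- move=> X g g' w gg' [h1 h2 h3 h4].
  have -> : (used g' X) = used g X.
    by apply/seteqP; split=> t [Y YX tY]; exists Y => //; move: tY; rewrite gg'.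
  by split=> // Y YX; rewrite -gg' //; exact: h2.
- move=> X g IH; have [t nt] := fresh g X.
  pose GG := [set F | F = F0 \/ exists2 Y, lt' Y X & F = (g Y).1].
  have gGG : good (\bigcup_(F in GG) F) (used g X).
    apply: good_union.
    - by exists F0; left.
    - move=> _ _ [->|[Y YX ->]] [->|[Y' YX' ->]]; first by left.
      + by left; have [] := IH Y' YX'.
      + by right; have [] := IH Y YX.
      have [YY'|[->|Y'Y]] := tot' Y Y' Logic.I Logic.I.
      + by left; have [_ /(_ Y YY')] := IH Y' YX'.
      + by left.
      + by right; have [_ /(_ Y' Y'Y)] := IH Y YX.
    - move=> _ [->|[Y YX ->]]; first by apply: good_sub gF0 => t'.
      have [_ _ + _] := IH Y YX; apply: good_sub => t' [[Y' Y'Y tY']|tY].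
        by exists Y' => //; exact: tr' YX.
      by exists Y.
  have [F' [ts [gF' FF' oF']]] := good_step (e (task_set X)) (task_seq X) gGG nt.
  exists (F', ts); split=> //= [A FA|Y YX A FA]; apply: FF'.
    by exists F0 => //; left.
  by exists (g Y).1 => //; right; exists Y.
pose GG := [set F | F = F0 \/ exists Y, F = (g Y).1].
have gGG : good (\bigcup_(F in GG) F) setT.
  apply: good_union.
  - by exists F0; left.
  - move=> _ _ [->|[Y ->]] [->|[Y' ->]]; first by left.
    + by left; have [] := gP Y'.
    + by right; have [] := gP Y.
    have [YY'|[->|Y'Y]] := tot' Y Y' Logic.I Logic.I.
    + by left; have [_ /(_ Y YY')] := gP Y'.
    + by left.
    + by right; have [_ /(_ Y' Y'Y)] := gP Y.
  - move=> _ [->|[Y ->]]; first by apply: good_sub gF0 => t'.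
    by have [_ _ + _] := gP Y; apply: good_sub.
have [iF mF] := gGG; exists (\bigcup_(F in GG) F); split=> // [B FB|C U].
  have [//|tau [_ _ /(_ (fun=> [::]))[b [y [Bb _ _ _]]]]] := mF B FB [::] [::].
  by exists b.
have [X [<- <-]] := task_ex C U; have [_ _ _] := gP X; apply: outcome_sub => A FA.
by exists (g X).1 => //; right; exists X.
Qed.

End Construction.

(** * Separation of uniform ultrafilters *)

(* J C is an initial segment of I of size |C|^+. *)
Lemma index_order_ex (S : Type) : inhabited S ->
  exists (I : eqType) (lt : I -> I -> Prop) (J : set S -> set I) (e : set S -> I -> I -> S),
  [/\ strict_well_order lt, forall th, [set al | lt al th] #<= [set: S],
      forall C, ~ (J C #<= C),
      forall C al th, J C th -> lt al th -> C (e C al th) &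
      forall C al al' th, J C th -> lt al th -> lt al' th -> e C al th = e C al' th -> al = al'].
Proof.
move=> [x0]; have [lt [wf tr tot ini]] := initial_well_order_ex [set: set S].
(* Points with at most |S| predecessors form a well-order of type |S|^+; [J C] is cut out by the
   bound |C| instead. *)
pose I0 := [set X | [set Y | lt Y X] #<= [set: S]].
pose I : eqType := {X : set S | `[< I0 X >]}.
pose ltI (al th : I) := lt (val al) (val th).
pose J (C : set S) := [set th : I | [set Y | lt Y (val th)] #<= C].
have /choice[e eP] : forall p : set S * I, exists f : I -> S, J p.1 p.2 ->
    (forall al, ltI al p.2 -> p.1 (f al)) /\
    (forall al al', ltI al p.2 -> ltI al' p.2 -> f al = f al' -> al = al').
  move=> [C th] /=; have [Jth|nJ] := pselect (J C th); last by exists (fun=> x0).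
  have [f fC finj] := card_le_injP x0 Jth.
  exists (fun al => f (val al)) => _; split=> [al|al al' h h' ff]; first exact: fC.
  exact/val_inj/finj.
exists I, ltI, J, (fun C al th => e (C, th) al); split.
- split=> [|x y z|x y]; [|exact: tr|].
    suff h X (al : I) : val al = X -> Acc ltI al by move=> al; exact: (h (val al)).
    elim/(well_founded_ind wf): X al => X IH al alX; split=> b; rewrite /ltI alX => bX.
    exact: (IH (val b)).
  have [|[/val_inj|]] := tot (val x) (val y) Logic.I Logic.I; by [left|right; left|right; right].
- move=> th; have /asboolP := valP th; apply: card_le_trans.
  by apply: (@card_le_of_inj _ _ _ _ val) => // x y _ _ /val_inj.
- move=> C JC; pose J' := [set X | [set Y | lt Y X] #<= C].
  have J'I0 X : J' X -> I0 X by move=> /card_le_trans; apply; exact: card_leT.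
  have {}JC : J' #<= C.
    apply: card_le_trans JC; apply: (@card_le_of_surj _ _ _ _ val) => X J'X.
    by exists (exist _ X (asboolT (J'I0 X J'X))).
  (* The first point outside [J'] would have its predecessors in [J'], hence at most |C| of them. If
     there is none, Cantor's theorem is contradicted. *)
  have [[X nX]|all] := pselect ((~` J') !=set0).
    have [{nX}X nX Xmin] := well_founded_min wf (ex_intro _ X nX).
    apply: nX; apply: card_le_trans JC; apply: subset_card_le => Y YX.
    by apply: contrapT => /Xmin.
  have [_] := card_lt_power [set: S]; apply.
  apply: card_le_trans (card_leT C); apply: card_le_trans JC; apply: subset_card_le => X _.
  by apply: contrapT => nX; apply: all; exists X.
- by move=> C al th Jth alth; have [eC _] := eP (C, th) Jth; exact: eC.
- move=> C al al' th Jth alth alth'; have [_ einj] := eP (C, th) Jth; exact: einj.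
Qed.

Lemma label_code_ex (S : Type) : regular_card [set: S] ->
  exists f : (seq S * seq (seq bool * seq nat) * seq S) * S -> S, injective f.
Proof.
move=> S_regular; have [c cinj] := pair_code_ex S_regular.
have [k kinj] := nat_code_ex S_regular; have [g ginj] := seq_code_ex S_regular.
exists (fun p => c (c (c (g p.1.1.1, k (pickle p.1.1.2)), g p.1.2), p.2)).
move=> [[[s l] G] x] [[[s' l'] G'] x'] /= /cinj[/cinj[/cinj[/ginj -> /kinj]]].
by move=> /(pcan_inj pickleK) -> /ginj -> ->.
Qed.

Section Separation.
Variable S : semigroupType.
Hypothesis S_regular : regular_card [set: S].

Definition misses (F : set (set S)) (D : set (beta S)) : Prop :=
  exists2 V, F V & forall p : beta S, D p -> ~ p V.

(** The weak P-set property of the closed set determined by [F]: the witness [V] is a basic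
    neighbourhood of it disjoint from [D]. *)
Definition separating (F : set (set S)) : Prop :=
  forall D : set (beta S), D #<= [set: S] -> D `<=` uniform_ultrafilters S ->
    (forall p : beta S, D p -> exists2 A, F A & ~ p A) -> misses F D.

Lemma beta_sub (p : beta S) (A B : set S) : A `<=` B -> p A -> p B.
Proof. exact: filterS. Qed.

Lemma beta_setI (p : beta S) (A B : set S) : p A -> p B -> p (A `&` B).
Proof. exact: filterI. Qed.

Lemma beta_set0 (p : beta S) : ~ p set0.
Proof. exact: filter_not_empty. Qed.

Lemma beta_setC (p : beta S) (A : set S) : ~ p A -> p (~` A).
Proof. by have [] := in_ultra_setVsetC A (beta_ultra p). Qed.

Lemma beta_setCN (p : beta S) (A : set S) : p A -> ~ p (~` A).
Proof. by move=> pA /(beta_setI pA); rewrite setICr; exact: beta_set0. Qed.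

Lemma beta_nonempty (p : beta S) (A : set S) : p A -> A !=set0.
Proof. by move=> pA; apply/set0P/eqP => A0; apply: (@beta_set0 p); rewrite -A0. Qed.

Lemma uniform_small (p : beta S) A : uniform_ultrafilters S p -> small S A -> ~ p A.
Proof. by move=> pU sA /pU /card_eqPle[_ SA]; exact: sA SA. Qed.

Lemma separating_of_linked (F : set (set S)) (I : eqType) (lt : I -> I -> Prop)
    (J : set S -> set I) (e : set S -> I -> I -> S) :
  F setT -> (forall A B, F A -> F B -> F (A `&` B)) ->
  strict_well_order lt -> (forall C, ~ (J C #<= C)) ->
  (forall C al th, J C th -> lt al th -> C (e C al th)) ->
  (forall C al al' th, J C th -> lt al th -> lt al' th -> e C al th = e C al' th -> al = al') ->
  (forall C (U : S -> set S), (forall x, F (U x)) -> exists2 V : I -> set S, forall th, F (V th) &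
     forall al th, lt al th -> small S (V al `&` V th `\` U (e C al th))) ->
  separating F.
Proof.
move=> FT FI [lt_wf _ lt_tot] JC eC einj linked_ex D0 D0S D0U D0F; apply: contrapT => D0m.
have [|M [MS MU MF Mm] Mmin] := @min_card_ex _ [set D : set (beta S) |
  [/\ D #<= [set: S], D `<=` uniform_ultrafilters S,
   forall p : beta S, D p -> exists2 A, F A & ~ p A & ~ misses F D]].
  by exists D0.
have infM : infinite_set M.
  move=> /finite_seqP[s Ms]; apply: Mm; rewrite Ms in MF *.
  elim: s MF {Ms} => [|p s IH] MF; first by exists setT => // p; rewrite /= in_nil.
  have [q qs|V FV Vs] := IH; first by apply: MF; rewrite /= inE qs orbT.
  have [|A FA npA] := MF p; first exact: mem_head.
  exists (V `&` A) => [|q]; first exact: FI.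
  rewrite /= inE => /orP[/eqP -> pVA|/Vs nqV qVA].
    by apply: npA; apply: beta_sub pVA => x [].
  by apply: nqV; apply: beta_sub qVA => x [].
have [ltM [_ _ ltM_tot ltM_ini]] := initial_well_order_ex M.
have [x0] := regular_inhabited S_regular.
have [c _ cinj] := card_le_injP x0 MS.
have segF eta : M eta -> misses F [set xi | M xi /\ ltM xi eta].
  move=> Meta; apply: contrapT => nm; apply: (ltM_ini _ Meta); apply: Mmin; split=> //.
  - by apply: card_le_trans MS; apply: subset_card_le => xi [].
  - by move=> xi [/MU].
  - by move=> xi [/MF].
(* [U (c eta)] is missed by all points of [M] before [eta]; indices that code no point get
   [setT]. *)
have /choice[U UP] : forall x, exists A, F A /\ forall eta, M eta -> x = c eta ->
    forall xi, M xi -> ltM xi eta -> ~ beta_set xi A.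
  move=> x; have [[eta [Meta ->]]|nx] := pselect (exists eta, M eta /\ x = c eta).
    have [A FA nA] := segF eta Meta; exists A; split=> // eta' Meta' /cinj.
    by move=> <- // xi Mxi xieta; apply: nA.
  by exists setT; split=> // eta Meta xE; exfalso; apply: nx; exists eta.
pose C := c @` M.
have [V FV Vsmall] := linked_ex C U (fun x => proj1 (UP x)).
have /choice[xi xiP] : forall th, exists p : beta S, M p /\ p (V th).
  move=> th; apply: contrapT => nth; apply: Mm; exists (V th) => // p Mp pV.
  by apply: nth; exists p.
pose A p := [set th | J C th /\ xi th = p].
(* For [al] before [th] in [A p], the uniform [p] contains [V al] and [V th], hence [U (e C al th)].
   So [e C al th] codes a point not after [p], and its injectivity in [al] bounds the predecessors
   of [th]. *)
have A_le p : M p -> A p #<= M.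
  move=> Mp; apply: (@card_le_of_small_preds _ _ _ _ lt) => // th [Jth xith] Mle.
  have infseg : ~ (M #<= [set q | M q /\ ltM q p] `|` [set p]).
    have [fin|inf] := pselect (finite_set [set q | M q /\ ltM q p]).
      move=> /card_le_finite fM; apply: infM; apply: fM.
      by rewrite finite_setU; split=> //; exact: finite_set1.
    by move=> h; apply: (ltM_ini p Mp); apply: card_le_trans h (card_setU1_infinite _ inf).
  apply: infseg; apply: card_le_trans Mle _.
  have /choice[g gP] : forall al, exists q, A p al /\ lt al th -> M q /\ e C al th = c q.
    move=> al; have [[_ ath]|nal] := pselect (A p al /\ lt al th); last by exists p.
    by have [q Mq qe] := eC C al th Jth ath; exists q.
  apply: (@card_le_of_inj _ _ _ _ g) => [al [Aal ath]|al al' [Aal ath] [Aal' ath'] gg]; last first.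
    have [_ e1] := gP al (conj Aal ath); have [_ e2] := gP al' (conj Aal' ath').
    by apply: (einj C al al' th) => //; rewrite e1 e2 gg.
  have [Mq qe] := gP al (conj Aal ath).
  have [|[->|pq]] := ltM_tot (g al) p Mq Mp; [by left|by right|exfalso].
  have [_ Up] := UP (e C al th); apply: (Up _ Mq qe p Mp pq).
  apply: contrapT => nU; apply: (uniform_small (MU p Mp) (Vsmall al th ath)).
  apply: beta_setI (beta_setC nU); apply: beta_setI; last by have [] := xiP th; rewrite xith.
  by have [_ xial] := Aal; have [] := xiP al; rewrite xial.
have /choice[h hP] : forall p, exists f : I -> beta S, M p -> (forall th, A p th -> M (f th)) /\
    (forall th th', A p th -> A p th' -> f th = f th' -> th = th').
  move=> p; have [Mp|nMp] := pselect (M p); last by exists xi.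
  by have [f fM finj] := card_le_injP p (A_le p Mp); exists f.
(* Pairing [xi th] with the place of [th] in [A (xi th)] injects [J C] into the square of [M], hence
   into [C]. *)
apply: (JC C); apply: (@card_le_trans _ _ _ M); last first.
  by apply: (@card_le_of_inj _ _ _ _ c) => // p Mp; exists p.
apply: card_le_trans (card_setM_infinite infM).
apply: (@card_le_of_inj _ _ _ _ (fun th => (xi th, h (xi th) th))) => [th Jth|th th' Jth Jth'].
  by have [Mxi _] := xiP th; split=> //=; have [+ _] := hP _ Mxi; apply.
move=> [xx hh]; have [Mxi _] := xiP th; have [_ hinj] := hP _ Mxi.
by apply: hinj; rewrite /A /= ?hh -?xx.
Qed.

End Separation.

Theorem separating_filter_ex (S : semigroupType) :
  regular_card [set: S] -> very_weakly_cancellative S ->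
  exists F : set (set S), [/\ ProperFilter F, separating F, forall A, small S (~` A) -> F A,
    forall s A, F A -> F [set b | A (s * b)] &
    forall A, F A \/ exists ss : seq S, F [set b | ~ (A b /\ forall s, s \in ss -> A (s * b))]].
Proof.
move=> S_regular S_vwc; have S_inh := regular_inhabited S_regular.
have [I [lt [J [e [lt_wo lt_preds JC eC einj]]]]] := index_order_ex S_inh.
have [f finj] := label_code_ex S_regular; have [x0] := S_inh.
have [d d_large] := large_fibers_ex S_regular (([::], [::], [::]), x0) finj.
have [Z [Z_sub Z_large Z_disj Z_small]] := tree_of_sets S_regular lt_wo lt_preds d_large.
have [a a_block] := disjoint_blocks (fun y => (d y).1.2) S_regular S_vwc.
have [F [iF F0 oF]] := @generic_filter_ex S I lt S_regular S_vwc lt_wo (fst \o d) a Z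
  a_block Z_sub Z_large Z_disj Z_small e.
exists F; split.
- apply: Build_ProperFilter_ex => //.
  split; [exact: inv_setT iF|exact: inv_setI iF|exact: inv_sub iF].
- apply: (separating_of_linked S_regular (inv_setT iF) (inv_setI iF) lt_wo JC eC einj).
  move=> C U FU; have [[etas [ss Fn]]|[_ //]] := oF C U; exfalso.
  suff /(inv_setI iF Fn)/F0[b []] : F (orbit_inter [seq U eta | eta <- etas] ss) by [].
  elim: etas {Fn} => [|eta etas IH] /=.
    by apply: inv_sub iF _ _ _ (inv_setT iF) => b _ A; rewrite in_nil.
  have Fss : F [set b | forall s, s \in ss -> U eta (s * b)].
    elim: ss {IH} => [|s ss IH]; first by apply: inv_sub iF _ _ _ (inv_setT iF) => b _ s; rewrite in_nil.
    apply: inv_sub iF _ _ _ (inv_setI iF (inv_translate iF s (FU eta)) IH) => b [sb ssb] s'.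
    by rewrite inE => /orP[/eqP ->|/ssb].
  apply: inv_sub iF _ _ _ (inv_setI iF (inv_setI iF (FU eta) Fss) IH) => b [[Ub Us] ob] A.
  by rewrite inE => /orP[/eqP ->|/ob].
- exact: inv_cosmall iF.
- by move=> s A FA; exact: (inv_translate iF s FA).
- move=> A; have [[etas [ss Fn]]|[FA _]] := oF set0 (fun=> A); last by left; exact: FA x0.
  right; exists ss; apply: inv_sub iF _ _ _ Fn => b nb [Ab As]; apply: nb => A' /mapP[x _ ->].
  by split.
Qed.

(** * The minimal left ideal *)

Section Ideals.
Variable S : semigroupType.

(** Filters encode closed subsets of the space of ultrafilters, with inclusion reversed. *)
Definition filter_closure (F : set (set S)) : set (beta S) :=
  [set p : beta S | forall A, F A -> p A].

Lemma filter_closure_nonempty (F : set (set S)) : ProperFilter F -> filter_closure F !=set0.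
Proof. by move=> FF; have [G [GU FG]] := ultraFilterLemma FF; exists (Beta GU). Qed.

Lemma filter_closure_mem (F : set (set S)) B : Filter F ->
  (forall p : beta S, filter_closure F p -> p B) -> F B.
Proof.
move=> FF FB; apply: contrapT => nFB.
have [p pP] : filter_closure [set A | exists2 C, F C & C `\` B `<=` A] !=set0.
  apply: filter_closure_nonempty; apply: Build_ProperFilter_ex => [A [C FC CA]|].
    apply: contrapT => nA; apply: nFB; apply: filterS FC => x Cx; apply: contrapT => nBx.
    by apply: nA; exists x; apply: CA.
  split; first by exists setT; [exact: filterT|].
    move=> A A' [C FC CA] [C' FC' CA']; exists (C `&` C'); first exact: filterI.
    by move=> x [[Cx C'x] nBx]; split; [exact: CA|exact: CA'].
  by move=> A A' AA' [C FC CA]; exists C => //; exact: subset_trans AA'.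
have /beta_setCN : p B by apply: FB => A FA; apply: pP; exists A => // x [].
by apply; apply: pP; exists setT; [exact: filterT|move=> x []].
Qed.

(** Compactness: right multiplication by [q] maps closed sets to closed sets, and the hypothesis
    puts [p] in the closure of the image. The filter [G] imposes both requirements on [r]. *)
Lemma beta_mul_lift (F : set (set S)) (p q : beta S) : Filter F ->
  (forall A, F [set s | q [set t | A (s * t)]] -> p A) ->
  exists2 r : beta S, filter_closure F r & r * q = p.
Proof.
move=> FF Fp; pose G := [set B | exists A C, [/\ F A, p C &
  A `&` [set s | q [set t | C (s * t)]] `<=` B]].
have [|r rG] := @filter_closure_nonempty G.
  apply: Build_ProperFilter_ex => [B [A [C [FA pC AB]]]|].
    apply: contrapT => nB; apply: (beta_setCN pC); apply: Fp.
    apply: filterS FA => s As; apply: beta_setC => qC.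
    by apply: nB; exists s; apply: AB.
  split; first by exists setT, setT; split=> //; exact: filterT.
    move=> B B' [A [C [FA pC AB]]] [A' [C' [FA' pC' AB']]].
    exists (A `&` A'), (C `&` C'); split; [exact: filterI|exact: beta_setI|].
    move=> s [[As A's] qs]; split; [apply: AB|apply: AB']; split=> //;
      by apply: beta_sub qs => t [].
  by move=> B B' BB' [A [C [FA pC AB]]]; exists A, C; split=> //; exact: subset_trans BB'.
have rq C : p C -> (r * q)%g C.
  by move=> pC; apply: rG; exists setT, C; split=> //; exact: filterT.
exists r => [A FA|].
  by apply: rG; exists A, setT; split=> //; exact: filterT.
apply: beta_eqP => A; split=> [rqA|]; last exact: rq.
by apply: contrapT => /beta_setC /rq /(beta_setCN rqA).
Qed.

Definition semigroup_filter (F G : set (set S)) : Prop :=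
  [/\ ProperFilter G, F `<=` G & forall p q, filter_closure G p -> filter_closure G q ->
    filter_closure G (p * q)].

Lemma maximal_semigroup_filter (F : set (set S)) : semigroup_filter F F ->
  exists2 G, semigroup_filter F G &
    forall G', semigroup_filter F G' -> G `<=` G' -> G' `<=` G.
Proof.
move=> FF; have [|G [Gok Gmax]] := @Zorn_bigcup _ [set G | G = set0 \/ semigroup_filter F G].
  move=> GG GGok tot; have [[G0 [GG0 G0ok]]|nG] := pselect
      (exists G, GG G /\ semigroup_filter F G); last first.
    left; apply/seteqP; split=> // A [G GGG GA]; have [G0|Gok] := GGok G GGG.
      by rewrite G0 in GA.
    by case: nG; exists G.
  right; have sup G A : GG G -> G A -> exists G', [/\ GG G', G' A & semigroup_filter F G'].
    move=> GGG GA; exists G; split=> //; have [G0'|//] := GGok G GGG.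
    by rewrite G0' in GA.
  split.
  - apply: Build_ProperFilter_ex => [A [G GGG GA]|].
      have [G' [_ G'A [G'P _ _]]] := sup G A GGG GA; exact: filter_ex G'A.
    split.
    + by exists G0 => //; have [? _ _] := G0ok; exact: filterT.
    + move=> A B [G1 GG1 G1A] [G2 GG2 G2B].
      have [G1' [GG1' G1A' [? _ _]]] := sup G1 A GG1 G1A.
      have [G2' [GG2' G2B' [? _ _]]] := sup G2 B GG2 G2B.
      have [h|h] := tot _ _ GG1' GG2'.
        by exists G2' => //; apply: filterI => //; exact: h.
      by exists G1' => //; apply: filterI => //; exact: h.
    + move=> A B AB [G GGG GA]; have [G' [GG' G'A [? _ _]]] := sup G A GGG GA.
      by exists G' => //; exact: filterS AB G'A.
  - by move=> A FA; exists G0 => //; have [_ FG _] := G0ok; exact: FG.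
  - move=> p q pG qG A [G GGG GA]; have [G' [GG' G'A [_ _ Gsg]]] := sup G A GGG GA.
    by apply: Gsg G'A => B GB; [apply: pG|apply: qG]; exists G'.
have {}Gok : semigroup_filter F G.
  case: Gok => // G0; exfalso; apply: (Gmax F); last by right.
  rewrite G0; split=> // F0; have [FP _ _] := FF; exact: (F0 setT (@filterT _ F _)).
exists G => // G' G'ok GG'; apply: contrapT => nG'G.
by apply: (Gmax G'); [split|right].
Qed.

(* Ellis and Numakura: a minimal closed subsemigroup is a single idempotent. *)
Lemma idempotent_ex (F : set (set S)) : semigroup_filter F F ->
  exists2 e : beta S, filter_closure F e & e * e = e.
Proof.
move=> /maximal_semigroup_filter[G [GP FG Gsg] Gmax].
have [e eG] := filter_closure_nonempty GP.
exists e => [A /FG/eG//|].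
(* [Ge] encodes the closed subsemigroup [filter_closure G * e]; maximality of [G] puts [e] in it. *)
pose Ge := [set A : set S | G [set s | e [set t | A (s * t)]]].
have GGe : G `<=` Ge.
  by move=> A GA; apply: (@filter_closure_mem G) => r rG; exact: (Gsg r e rG eG A GA).
have Ge_lift p : filter_closure Ge p -> exists2 r, filter_closure G r & r * e = p.
  by move=> pGe; apply: (@beta_mul_lift G) => A GA; exact: pGe.
have GeG : Ge `<=` G.
  apply: Gmax => //; split; last 2 first.
  - exact: subset_trans GGe.
  - move=> p q /Ge_lift[r rG <-] /Ge_lift[r' r'G <-] A GeA.
    rewrite mulgA; have rG' := Gsg _ _ (Gsg _ _ rG eG) r'G.
    by apply/beta_mulE; exact: rG'.
  apply: Build_ProperFilter_ex => [A GA|].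
    have [s /beta_nonempty[t At]] := @filter_ex _ G GP _ GA.
    by exists (s * t).
  split.
  - by apply: (@filterS _ G _ setT) => [s _|]; exact: filterT.
  - move=> A B GA GB; apply: (@filterS _ G _ _ _ _ (@filterI _ G _ _ _ GA GB)) => s [eA eB].
    exact: (beta_setI eA eB).
  - by move=> A B AB; apply: (@filterS _ G) => s; apply: beta_sub => t; exact: AB.
have [|r0 r0G r0e] := Ge_lift e; first by move=> A /GeG; exact: eG.
(* [Y] encodes the solutions of [p * e = e] in [filter_closure G], a closed subsemigroup containing
   [r0]; by maximality it contains [e]. *)
pose Y := [set B | exists A C, [/\ G A, e C & A `&` [set s | e [set t | C (s * t)]] `<=` B]].
have Y_closure p : filter_closure Y p -> filter_closure G p /\ p * e = e.
  move=> pY; split=> [A GA|].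
    by apply: pY; exists A, setT; split=> //; exact: filterT.
  have eC C : e C -> (p * e)%g C.
    by move=> eC; apply: pY; exists setT, C; split=> //; exact: filterT.
  apply: beta_eqP => A; split=> [pA|]; last exact: eC.
  by apply: contrapT => /beta_setC /eC /(beta_setCN pA).
have closure_Y p : filter_closure G p -> p * e = e -> filter_closure Y p.
  move=> pG pe B [A [C [GA eC AB]]]; apply: beta_sub AB _; apply: beta_setI; first exact: pG.
  by move: eC; rewrite -{1}pe.
have YG : Y `<=` G.
  apply: Gmax; last by move=> A GA; exists A, setT; split=> //; exact: filterT.
  split.
  - apply: Build_ProperFilter_ex => [B YB|].
      by have := closure_Y r0 r0G r0e B YB; exact: beta_nonempty.
    split; first by exists setT, setT; split=> //; exact: filterT.
    + move=> B B' [A [C [FA pC AB]]] [A' [C' [FA' pC' AB']]].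
      exists (A `&` A'), (C `&` C'); split; [exact: filterI|exact: beta_setI|].
      move=> s [[As A's] qs]; split; [apply: AB|apply: AB']; split=> //;
        by apply: beta_sub qs => t [].
    + by move=> B B' BB' [A [C [FA pC AB]]]; exists A, C; split=> //; exact: subset_trans BB'.
  - by move=> A /FG GA; exists A, setT; split=> //; exact: filterT.
  - move=> p q /Y_closure[pG pe] /Y_closure[qG qe]; apply: closure_Y; first exact: Gsg.
    by rewrite -mulgA qe.
by have [] := Y_closure e (fun A YA => eG A (YG A YA)).
Qed.

End Ideals.

(** * The closed left ideal of a separating, maximal invariant filter *)

Section MinimalIdeal.
Variables (S : semigroupType) (F : set (set S)).
Hypothesis S_regular : regular_card [set: S].
Hypothesis S_vwc : very_weakly_cancellative S.
Hypothesis F_proper : ProperFilter F.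
Hypothesis F_separating : separating F.
Hypothesis F_cosmall : forall A, small S (~` A) -> F A.
Hypothesis F_translate : forall s A, F A -> F [set b | A (s * b)].
Hypothesis F_maximal : forall A,
  F A \/ exists ss : seq S, F [set b | ~ (A b /\ forall s, s \in ss -> A (s * b))].

Let L := filter_closure F.
Let U := uniform_ultrafilters S.

Lemma closure_mull p q : L q -> L (p * q).
Proof.
move=> qL A FA; apply: beta_sub (@filterT _ p _) => s _; apply: qL; exact: F_translate.
Qed.

Lemma uniform_mull (p q : beta S) : U q -> U (p * q).
Proof.
move=> qU A pqA; have /beta_nonempty[s qs] : p [set s | q [set t | A (s * t)]] := pqA.
apply/card_eqPle; split; first exact: card_leT.
apply: contrapT => sA; have sAs : small S (translate s A) by exact: small_translate.
exact: (uniform_small qU sAs qs).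
Qed.

Lemma closure_uniform : L `<=` U.
Proof.
move=> p pL A pA; apply/card_eqPle; split; first exact: card_leT.
apply: contrapT => sA; apply: (beta_setCN pA); apply: pL; apply: F_cosmall.
by rewrite setCK.
Qed.

(** By lifting from the trivial filter, it suffices that [p] contains every [A] all of whose
    translates are in [q]. If [A] were not in [F], maximality would put the complement of a finite
    intersection of translates of [A] into [F], contradicting [q]. *)
Lemma closure_left_simple p q : L p -> L q -> exists r, r * q = p.
Proof.
have FT : Filter [set (setT : set S)].
  split=> // [A B -> ->|A B AB AT]; first by rewrite setTI.
  by apply/seteqP; split=> // x _; apply: AB; rewrite AT.
move=> pL qL; have [|r _ rq] := @beta_mul_lift S [set setT] p q FT; last by exists r.
move=> A /seteqP[_ qA]; apply: pL; have [//|[ss Fn]] := F_maximal A; exfalso.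
(* Shifting by [x0] is necessary: [q] is known to contain the translates of [A], not [A] itself. *)
have [x0] := regular_inhabited S_regular; have := qL _ (F_translate x0 Fn).
apply: beta_setCN; apply: beta_sub (_ : q [set b | A (x0 * b) /\ forall s, s \in ss -> A (s * (x0 * b))]).
  by move=> b Ab /=; apply: contrapT.
apply: beta_setI (qA x0 Logic.I) _.
elim: ss {Fn} => [|s ss IH]; first by apply: beta_sub (@filterT _ q _) => b _ s; rewrite in_nil.
apply: beta_sub (beta_setI (qA (s * x0) Logic.I) IH) => b [sb ssb] s'.
by rewrite inE => /orP[/eqP ->|/ssb //]; rewrite mulgA.
Qed.

Lemma minimal_left_ideal_closure : minimal_left_ideal [set: beta S] L.
Proof.
split; first by split=> // [|p q _]; [exact: filter_closure_nonempty|exact: closure_mull].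
move=> L' [[q qL'] _ L'mul] [L'L]; apply => p pL.
by have [r <-] := closure_left_simple pL (L'L q qL'); exact: L'mul.
Qed.

Lemma minimal_left_ideal_uniform : minimal_left_ideal U L.
Proof.
split.
  split; [exact: filter_closure_nonempty|exact: closure_uniform|].
  by move=> p q _; exact: closure_mull.
move=> L' [[q qL'] _ L'mul] [L'L]; apply => p pL.
have qU : U q by apply/closure_uniform/L'L.
(* Since [r] may fail to be uniform, [p] is written as [r * (q * q)]; the left factor becomes the
   uniform [r * q]. *)
have [r <-] := closure_left_simple pL (L'L _ (L'mul q q qU qL')).
by rewrite mulgA; apply: L'mul => //; exact: uniform_mull.
Qed.

Lemma not_closure p : ~ L p -> exists2 A, F A & ~ p A.
Proof.
move=> nLp; apply: contrapT => nA; apply: nLp => A FA; apply: contrapT => npA.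
by apply: nA; exists A.
Qed.

Lemma weak_Pset_closure (V : Type) (M : set V) :
  is_succ_card [set: S] M -> weak_Pset M U L.
Proof.
move=> MS; split=> [|D DUL DM]; first exact: closure_uniform.
have DU : D `<=` U by move=> p /DUL[].
have [|p /DUL[_ /not_closure]//|B FB Bp] := F_separating _ DU; first exact/(lt_succ_card D MS).
rewrite closure_subspaceW //; apply/seteqP; split=> // p [[clp _] pL].
have [|q [Dq qB]] := clp (beta_base B); last exact: Bp Dq qB.
apply: open_nbhs_nbhs; split; last exact: pL.
by exists [set B] => //; rewrite bigcup_set1.
Qed.

(** * Primeness and maximal idempotents under left cancellation *)

Section LeftCancellative.
Hypothesis S_lc : left_cancellative S.

Lemma principal_ultra (s : S) : UltraFilter (principal_filter s).
Proof.
apply: ultra_of_setVsetC; first exact: principal_filter_proper.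
by move=> A; have [As|nAs] := pselect (A s); [left|right]; apply/principal_filterP.
Qed.

Definition principal (s : S) : beta S := Beta (principal_ultra s).

Lemma principal_mulE s (q : beta S) A : (principal s * q)%g A <-> q [set t | A (s * t)].
Proof. exact: principal_filterP. Qed.

(** Left cancellation makes [A] the preimage of its image under [s], so [s * q] determines [q]. *)
Lemma principal_mul_inj s : injective (fun q : beta S => principal s * q).
Proof.
move=> q q' /= e; apply: beta_eqP => A.
have imE : [set t | [set s * u | u in A] (s * t)] = A.
  by apply/seteqP; split=> t; [move=> [u Au /S_lc <-]|move=> At; exists t].
by rewrite -{1 2}imE -!principal_mulE e.
Qed.

Lemma prime_closure : prime_in U L.
Proof.
move=> p q pU qU; split=> [pqL|]; last exact: closure_mull.
have [[s sqL]|nsq] := pselect (exists s, L (principal s * q)).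
  have [|e eL ee] := @idempotent_ex S F.
    by split=> // p1 p2 _; exact: closure_mull.
  have [r re] := closure_left_simple sqL eL.
  (* As [s * q = r * e], right multiplication by [e] fixes [s * q]; cancelling [s] gives the
     claim. *)
  suff <- : q * e = q by exact: closure_mull.
  by apply: (@principal_mul_inj s); rewrite /= mulgA -re -mulgA ee.
(* Otherwise some [B] in [F] belongs to no [s * q], whereas [B] in [p * q] provides an [s] with [B]
   in [s * q]. *)
exfalso; pose D := (fun s => principal s * q) @` [set: S].
have [||p' [s _ <-]|B FB DB] := F_separating (D := D).
- exact: card_image_le.
- by move=> _ [s _ <-]; exact: uniform_mull.
- by apply: not_closure => sqL; apply: nsq; exists s.
have /beta_nonempty[s qs] : p [set s | q [set t | B (s * t)]] := pqL B FB.
by apply: (DB (principal s * q)); [exists s|apply/principal_mulE].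
Qed.

(** An idempotent of a minimal left ideal is a right identity on it, and primeness forces every
    idempotent above [p] into [L]. *)
Lemma idempotent_closure p : L p -> idempotent_elt p ->
  [/\ left_maximal_idempotent U p, minimal_idempotent U p & maximal_idempotent U p].
Proof.
move=> pL pp; have pU := closure_uniform pL.
have right_id q : L q -> q * p = q.
  by move=> qL; have [r <-] := closure_left_simple qL pL; rewrite -mulgA pp.
have above q : idempotents U q -> idem_leL p q -> L q.
  by move=> [qU _] pq; apply/(prime_closure pU qU); rewrite pq.
split; split=> // q qI.
- by move=> /above h; apply: right_id; exact: h.
- move=> [qp pq]; have qL : L q by rewrite -qp; exact: closure_mull.
  have [r rq] := closure_left_simple pL qL; have [_ qq] := qI.
  by rewrite -pq -rq -mulgA qq.
- move=> [pq qp]; have := right_id q (above q qI pq).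
  by rewrite qp.
Qed.

End LeftCancellative.
End MinimalIdeal.

Theorem mainTheorem2 (S : semigroupType)
    (S_regular : regular_card [set: S])
    (S_vwc : very_weakly_cancellative S) :
  exists L : set (beta S),
    [/\ minimal_left_ideal [set: beta S] L,
        minimal_left_ideal (uniform_ultrafilters S) L,
        forall (V : Type) (kappa_plus : set V),
          is_succ_card [set: S] kappa_plus ->
          weak_Pset kappa_plus (uniform_ultrafilters S) L
      & left_cancellative S ->
          prime_in (uniform_ultrafilters S) L /\
          forall p : beta S, L p -> idempotent_elt p ->
            [/\ left_maximal_idempotent (uniform_ultrafilters S) p,
                minimal_idempotent (uniform_ultrafilters S) p
              & maximal_idempotent (uniform_ultrafilters S) p]].
Proof.
have [F [FP Fsep Fco Ftr Fmax]] := separating_filter_ex S_regular S_vwc.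
exists (filter_closure F); split.
- exact: minimal_left_ideal_closure.
- exact: minimal_left_ideal_uniform.
- by move=> V M; exact: weak_Pset_closure.
- move=> S_lc; split; first exact: prime_closure.
  by move=> p; exact: idempotent_closure.
Qed.
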